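(* Fix any constant $c\in(0,1/5)$. Then there is $\varepsilon_0=\varepsilon_0(c)>0$ such that for every $0<\varepsilon<\varepsilon_0$ there exists $n_0\in\mathbb{N}$ such that the following holds for all integers $n,s$ with $n\ge n_0$ and $cn\le s\le n/5$. If $G$ is a stable $4$-graph on $[n]$ with $\nu(G)\le s$ and $e(G)\ge \binom{n}{4}-\binom{n-s}{4}-\varepsilon n^4$, then $G$ is $400\varepsilon^{1/4}$-close to $H_1$.
   Context: A $k$-graph on $[n]=\{1,\dots,n\}$ is a family of $k$-element subsets (edges) of $[n]$; $e(G)$ is its number of edges and $\nu(G)$ its matching number (maximum number of pairwise disjoint edges). A $k$-graph $G$ on $[n]$ is stable if for every edge $\{a_1,\dots,a_k\}\in E(G)$ and every $\{b_1,\dots,b_k\}\in\binom{[n]}{k}$ with $b_i\le a_i$ for all $i$, also $\{b_1,\dots,b_k\}\in E(G)$. For two $k$-graphs $G,H$ on the same $n$-element vertex set and $\varepsilon>0$, $G$ is $\varepsilon$-close to $H$ if $|E(H)\setminus E(G)|<\varepsilon n^k$. Here $H_1$ is the $4$-graph on $[n]$ whose edges are all $e\in\binom{[n]}{4}$ with $e\cap[s]\neq\emptyset$. *)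

(* Defs.v *)
From mathcomp Require Import all_boot all_order all_algebra.
Set Implicit Arguments.
Unset Strict Implicit.
Unset Printing Implicit Defensive.
Import GRing.Theory Num.Theory.

(* Vertices are numbered from 0: the ordinal i : 'I_n stands for the vertex
   i + 1 of [n] = {1, ..., n}. *)

Definition is_kgraph (n k : nat) (G : {set {set 'I_n}}) : Prop :=
  forall e, e \in G -> #|e| = k.

(* The labellings a and b are not required to be increasing. *)
Definition is_stable (n k : nat) (G : {set {set 'I_n}}) : Prop :=
  forall a b : 'I_k -> 'I_n, injective a -> injective b ->
    (forall i, (b i <= a i)%N) ->
    [set a i | i : 'I_k] \in G -> [set b i | i : 'I_k] \in G.

Definition matching_number (n : nat) (G : {set {set 'I_n}}) : nat :=
  \max_(M : {set {set 'I_n}} | (M \subset G) && trivIset M) #|M|.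

Definition eps_close (R : numDomainType) (n k : nat) (eps : R)
    (G H : {set {set 'I_n}}) : Prop :=
  (#|H :\: G|%:R < eps * n%:R ^+ k :> R)%R.

(* [s] = {1, ..., s} is the set of ordinals i < s. *)
Definition H1 (n s : nat) : {set {set 'I_n}} :=
  [set e : {set 'I_n} |
    (#|e| == 4) && (e :&: [set i : 'I_n | (i < s)%N] != set0)].

(* Main.v *)
Require Import Defs.
From HB Require Import structures.
From mathcomp Require Import all_boot all_order all_algebra perm.
From mathcomp Require Import ring lra zify.
From mathcomp Require boolp.
From mathcomp Require Import reals sequences exp.
Set Implicit Arguments.
Unset Strict Implicit.
Unset Printing Implicit Defensive.
Import Order.TTheory GRing.Theory Num.Theory.

(** Idea. Because G is stable, its matching number and its fractional matching
number differ by o(n): group the vertices into blocks of equal length; shifting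
an edge down by one block makes every choice of vertices in the blocks of the
shifted edge an edge, so a fractional matching of the blocks can be realised by
vertices. By duality (here, by multiplicative weights) there is a nonincreasing
W : [n] -> [0, 1] of total weight at most s + o(n) with W(e) >= 1 for e in G.

Let T = [s], B its complement, Y the number of quadruples of B with W-sum at
least 1 and X the number of quadruples with one vertex in T, three in B and
W-sum less than 1. The first contain the edges of G outside H_1, the second are
non-edges, so it is enough to show 4X >= (1 + 1/400) Y: then the edges of G
outside H_1 are at most a constant times the deficiency eps n^4.

Let theta be the largest weight on B, tau = 1 - theta, V = W / tau on B,
Z = (1 - W) / tau on T and r = theta / tau; thus 0 <= V <= r and 0 <= Z <= 1,
and 4 E V <= E Z when |B| = 4|T|. Write m = 4 E V and compare A = P(V1 + V2 + V3 + V4 >= 1 + r)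
with P(S < Z) for S = V1 + V2 + V3. From 1[S < Z] >= (Z - S) 1[S < m] and
1[S < Z] >= (2Z - max(2S, 1)) 1[S < m] one gets two lower bounds on P(S < Z),
each improved by a multiple of A because S is large on the event defining A;
upper bounds for A come from replacing V by r times a Bernoulli variable, which
increases the expectation of convex functions. It remains to check a polynomial
inequality in r and u = E V on [1/3, 1] x [0, 1/4]: for r < 1/3 the event of A is
empty, and for r > 1 one may cap V at 1. *)

(** * Realising block types by a matching *)

Section Embedding.
Variables (n m L : nat) (G : {set {set 'I_n}}).
Implicit Type t : {ffun 'I_4 -> 'I_L}.

(* By stability, every choice of one vertex in each of the blocks
   [m * t i, m * (t i).+1) is then an edge. *)
Definition edge_above t := exists a : 'I_4 -> 'I_n,
  [/\ injective a, [set a i | i : 'I_4] \in G & forall i, m * (t i).+1 <= a i].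

Definition mult t (I : 'I_L) := \sum_(i < 4) (t i == I).

Definition load (ts : seq {ffun 'I_4 -> 'I_L}) (I : 'I_L) := \sum_(t <- ts) mult t I.

(** Induction on [ts], with the invariant that the matching occupies only the first [load ts I]
    positions of each block [I]. A new type takes the next free positions, which exist because loads
    stay at most [m]; they lie below the edge supplied by [edge_above], so stability makes them an
    edge. *)
Lemma matching_of_types ts : m * L <= n -> is_kgraph 4 G -> is_stable 4 G ->
  {in ts, forall t, edge_above t} -> (forall I, load ts I <= m) ->
  exists M : {set {set 'I_n}}, [/\ M \subset G, trivIset M, #|M| = size ts &
    forall v : 'I_n, v \in cover M ->
      exists2 I : 'I_L, m * I <= v & v < m * I + load ts I].
Proof.
move=> mL Gk Gst; elim: ts => [|t ts IH] above ld.
  exists set0; rewrite sub0set cards0; split => //.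
    by apply/trivIsetP => A B; rewrite inE.
  by move=> v; rewrite /cover big_set0 inE.
have loadE I : load (t :: ts) I = mult t I + load ts I by rewrite /load big_cons.
have [|I|M [MG trM cM covM]] := IH.
- by move=> t' t't; apply: above; rewrite inE t't orbT.
- by apply: leq_trans (ld I); rewrite loadE leq_addl.
have [a [ainj aG ta]] := above t (mem_head _ _).
(* Counting the earlier coordinates with the same block gives distinct vertices to a type that
   repeats a block. *)
pose rank (i : 'I_4) := \sum_(j < 4 | j < i) (t j == t i).
have rank_lt (i j : 'I_4) : t i = t j -> i < j -> rank i < rank j.
  move=> tij ij; rewrite /rank [ltnRHS](bigD1 i) //= tij eqxx add1n ltnS.
  rewrite [leqLHS]big_mkcond [leqRHS]big_mkcond; apply: leq_sum => k _.
  case: ifP => // ki; rewrite ifT //; have := ki; have := ij.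
  by rewrite -val_eqE /=; lia.
have rank_mult i : rank i < mult t (t i).
  rewrite /rank /mult [ltnRHS](bigD1 i) //= eqxx add1n ltnS.
  rewrite [leqLHS]big_mkcond [leqRHS]big_mkcond; apply: leq_sum => k _.
  by case: ifP => // ki; rewrite ifT // -val_eqE /=; lia.
pose b0 (i : 'I_4) := m * t i + load ts (t i) + rank i.
have off i : load ts (t i) + rank i < m.
  apply: leq_trans (ld (t i)); rewrite loadE addnC ltn_add2r; exact: rank_mult.
have b0n i : b0 i < n.
  apply: leq_trans mL; apply: (@leq_trans (m * (t i).+1)); last by rewrite leq_mul2l ltn_ord orbT.
  by rewrite mulnS /b0; have := off i; lia.
pose b i := Ordinal (b0n i).
have interval (I I' : 'I_L) x y : x < m -> y < m -> m * I + x = m * I' + y -> I = I'.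
  move=> xm ym e; apply: val_inj => /=; have m0 : 0 < m by lia.
  have := congr1 (divn^~ m) e.
  by rewrite /= ![m * _]mulnC !divnMDl // !divn_small // !addn0.
have binj : injective b.
  move=> i j /(congr1 val) /=; rewrite /b0 -!addnA => e.
  have tij := interval _ _ _ _ (off i) (off j) e.
  case: (ltngtP i j) => [ij|ij|/val_inj //].
    by have := rank_lt _ _ tij ij; move: e; rewrite tij; lia.
  by have := rank_lt _ _ (esym tij) ij; move: e; rewrite tij; lia.
pose e := [set b i | i : 'I_4].
have eG : e \in G.
  apply: Gst ainj binj _ aG => i; apply: leq_trans (ta i) => /=.
  by rewrite mulnS [m + _]addnC /b0 -addnA leq_add2l ltnW // off.
have edisj (A : {set 'I_n}) : A \in M -> [disjoint e & A].
  move=> AM; rewrite disjoints_subset; apply/subsetP => v /imsetP[i _ ->].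
  rewrite inE; apply/negP => bA.
  have [|I] := covM (b i); first by apply/bigcupP; exists A.
  rewrite /= /b0 => h1 h2.
  have ldI : load ts I <= m by apply: leq_trans (ld I); rewrite loadE leq_addl.
  have x : m * t i + (load ts (t i) + rank i) = m * I + (b0 i - m * I).
    by rewrite addnA subnKC.
  have tI : t i = I by apply: interval x => //; rewrite /b0; lia.
  by move: h2; rewrite tI; lia.
have M0 : set0 \notin M.
  by apply/negP => /(subsetP MG) /Gk; rewrite cards0.
have [trE eM] := trivIsetU1 edisj trM M0.
exists (e |: M); split => //.
- by rewrite subUset sub1set eG.
- by rewrite cardsU1 eM cM.
move=> v; rewrite /cover bigcup_setU big_set1 inE => /orP[/imsetP[i _ ->]|/covM[I h1 h2]].
  exists (t i); rewrite /= /b0; first by rewrite -addnA leq_addr.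
  by rewrite loadE -addnA ltn_add2l addnC ltn_add2r rank_mult.
by exists I => //; rewrite loadE; lia.
Qed.
End Embedding.

(** * Counting labelled edges *)

Lemma card_labellings (T : finType) (k : nat) (S : {set {set T}}) :
  (forall e, e \in S -> #|e| = k) ->
  #|[set f : {ffun 'I_k -> T} | injectiveb f & [set f i | i : 'I_k] \in S]| = k`! * #|S|.
Proof.
move=> Sk; rewrite -sum1dep_card.
rewrite (partition_big (fun f : {ffun 'I_k -> T} => [set f i | i : 'I_k]) (mem S)) /=; last first.
  by move=> f /andP[].
rewrite mulnC -sum_nat_const; apply: eq_bigr => e eS.
rewrite sum1dep_card; transitivity (#|e| ^_ #|'I_k|).
  rewrite -card_inj_ffuns_on; apply: eq_card => f; rewrite !inE.
  apply/idP/idP => [/andP[/andP[finj _] /eqP <-]|/andP[/ffun_onP fe finj]].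
    by rewrite finj andbT; apply/ffun_onP => i; apply: imset_f.
  have im : [set f i | i : 'I_k] = e.
    apply/eqP; rewrite eqEcard; apply/andP; split.
      by apply/subsetP => v /imsetP[i _ ->]; apply: fe.
    by rewrite card_imset ?card_ord ?Sk //; apply/injectiveP.
  by rewrite finj im eS eqxx.
by rewrite Sk // card_ord ffactnn.
Qed.

(** Moving the last coordinate, the only one in [A], to each of the four positions is injective: the
    chosen position is recovered as the one whose value lies in [A]. *)
Lemma one_top_labellings (T : finType) (A : {set T}) (S : {set {set T}}) :
  4 * #|[set f : {ffun 'I_4 -> T} | [&& injectiveb f, [set f i | i : 'I_4] \in S
           & [forall i, (f i \in A) == (i == ord_max)]]]|
  <= #|[set f : {ffun 'I_4 -> T} | injectiveb f & [set f i | i : 'I_4] \in S]|.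
Proof.
set Q := (X in 4 * #|pred_of_set X| <= _).
have QP f : f \in Q -> [/\ injective f, [set f i | i : 'I_4] \in S &
    forall i, (f i \in A) = (i == ord_max)].
  by rewrite inE => /and3P[/injectiveP ? ? /forallP h]; split => // i; apply/eqP.
pose h (x : 'I_4 * {ffun 'I_4 -> T}) := [ffun i => x.2 (tperm x.1 ord_max i)].
have <- : #|setX [set: 'I_4] Q| = 4 * #|Q| by rewrite cardsX cardsT card_ord.
rewrite -(card_in_imset (f := h)); last first.
  move=> [p f] [p' f']; rewrite !in_setX /= => /andP[_ /QP[_ _ fA]] /andP[_ /QP[_ _ fA']] /ffunP hh.
  have pp : p = p'.
    apply/eqP; have := congr1 (fun x => x \in A) (hh p).
    rewrite !ffunE /= fA fA' tpermL eqxx => /esym/eqP e.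
    by apply/eqP; rewrite -(tpermK p' ord_max p) e tpermR.
  rewrite -pp in hh *; congr (_, _); apply/ffunP => i.
  by have := hh (tperm p ord_max i); rewrite !ffunE /= tpermK.
apply/subset_leq_card/subsetP => _ /imsetP[[p f] /= fQ ->].
move: fQ; rewrite in_setX => /andP[_ /QP[finj fS _]]; rewrite inE; apply/andP; split.
  by apply/injectiveP => i j; rewrite !ffunE => /finj /perm_inj.
congr (_ \in S): fS; apply/setP => v; apply/imsetP/imsetP => -[i _ ->].
  by exists (tperm p ord_max i) => //; rewrite ffunE /= tpermK.
by exists (tperm p ord_max i) => //; rewrite ffunE.
Qed.

Lemma card_H1 n s : (s <= n)%N -> (#|H1 n s| + 'C(n - s, 4))%N = 'C(n, 4).
Proof.
move=> sn; pose A := [set i : 'I_n | (i < s)%N].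
have cA : #|A| = s.
  rewrite -sum1dep_card -(big_ord_widen n (fun=> 1%N)) // sum1_card card_ord //.
have cC : #|~: A| = (n - s)%N by have := cardsC A; rewrite card_ord cA; lia.
rewrite -cC -cards_draws -[RHS](_ : #|[set e : {set 'I_n} | #|e| == 4]| = _); last first.
  by rewrite card_draws card_ord.
rewrite -(cardsID (H1 n s) [set e : {set 'I_n} | #|e| == 4]); congr (_ + _)%N.
  by apply: eq_card => e; rewrite !inE andbA andbb.
apply: eq_card => e; rewrite !inE -disjoints_subset -setI_eq0 -/A.
by case: (#|e| == 4); case: (_ == set0).
Qed.

Lemma H1_edge n s (e : {set 'I_n}) : #|e| = 4%N ->
  reflect (exists2 v : 'I_n, v \in e & (v < s)%N) (e \in H1 n s).
Proof.
move=> e4; rewrite inE e4 eqxx /=.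
apply: (iffP (set0Pn _)) => -[v]; first by rewrite !inE => /andP[]; exists v.
by move=> ve vs; exists v; rewrite !inE ve.
Qed.

Local Open Scope ring_scope.

(** * The polynomial inequality *)

Lemma box_monomial_ge0 (R : realFieldType) (n m i j : nat) (x y z w : R) :
  0 <= x -> 0 <= y -> 0 <= z -> 0 <= w ->
  0 <= x ^+ i * y ^+ (n - i) * (z ^+ j * w ^+ (m - j)).
Proof. by move=> *; rewrite !mulr_ge0 ?exprn_ge0. Qed.

(* A polynomial of degree n in r and m in u with positive Bernstein coefficients
   on a rectangle is positive there: the products of powers of the distances to
   the four sides are handed to a linear solver. The bounds of the rectangle must
   be written as quotients. *)
Ltac bernstein_row n m i x y z w j :=
  let H := fresh in
  have H := box_monomial_ge0 n m i j x y z w; rewrite /subn /= in H;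
  lazymatch j with O => idtac | S ?k => bernstein_row n m i x y z w k end.
Ltac bernstein_rows n m x y z w i :=
  bernstein_row n m i x y z w m;
  lazymatch i with O => idtac | S ?k => bernstein_rows n m x y z w k end.
Ltac bernstein n m :=
  let r0 := fresh in let r1 := fresh in let u0 := fresh in let u1 := fresh in
  rewrite -![_ / _ <= _]subr_ge0 -![_ <= _ / _]subr_ge0 => r0 r1 u0 u1;
  bernstein_rows n m r0 r1 u0 u1 n; lra.

Section Numeric.
Variables (R : realFieldType) (r u A X : R).

(** These inequalities feed [compare_bounds]. Those named [_first], and [poly_top_r], combine its
    hypothesis [h1] with a tail bound, after division by [u]; those named [_second] combine [h2]
    with a tail bound for [u] near 1/4. *)
Lemma poly_small_r_first : 1/3 <= r -> r <= 9/20 -> 0/1 <= u -> u <= 21/100 ->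
  (1/4 + 4 * u - 3/4 * r) * u ^+ 3 <= 99/100 * (1 - 2 * r) * r ^+ 3.
Proof. bernstein 4%N 4%N. Qed.

Lemma poly_small_r_second : 1/3 <= r -> r <= 9/20 -> 21/100 <= u -> u <= 1/4 ->
  3/2 * (1 - r) * u ^+ 4 <= (1 - 2 * r) *
   (199/100 * u * r ^+ 3 - (r - u) ^+ 3 - 3 * (1 - 2 * r) * u * (r - u) ^+ 2).
Proof. bernstein 4%N 4%N. Qed.

Lemma poly_middle_r_first : 9/20 <= r -> r <= 3/5 -> 0/1 <= u -> u <= 21/100 ->
  (1/4 + 4 * u - 3/4 * r) * (4 * u ^+ 2 * r - 2 * u ^+ 3)
    <= 99/100 * (1 - r) * r ^+ 3.
Proof. bernstein 4%N 4%N. Qed.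

Lemma poly_below_half_second : 9/20 <= r -> r <= 1/2 -> 21/100 <= u -> u <= 1/4 ->
  3/2 * (4 * u ^+ 3 * r - 2 * u ^+ 4) <=
   199/100 * u * r ^+ 3 - (r - u) ^+ 3 - 3 * (1 - 2 * r) * u * (r - u) ^+ 2.
Proof. bernstein 3%N 4%N. Qed.

Lemma poly_above_half_second : 1/2 <= r -> r <= 3/5 -> 21/100 <= u -> u <= 1/4 ->
  3/2 * (4 * u ^+ 3 * r - 2 * u ^+ 4) <= 199/100 * u * r ^+ 3 - (r - u) ^+ 3.
Proof. bernstein 3%N 4%N. Qed.

Lemma poly_large_r_first : 3/5 <= r -> r <= 4/5 -> 0/1 <= u -> u <= 47/200 ->
  (1/4 + 4 * u - 3/4 * r) * (4 * u ^+ 2 * r - 2 * u ^+ 3)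
    <= 99/100 * (1 - r) * r ^+ 3.
Proof. bernstein 4%N 4%N. Qed.

Lemma poly_large_r_second : 3/5 <= r -> r <= 4/5 -> 47/200 <= u -> u <= 1/4 ->
  3/2 * (4 * u ^+ 3 * r - 2 * u ^+ 4) <= 199/100 * u * r ^+ 3 - (r - u) ^+ 3.
Proof. bernstein 3%N 4%N. Qed.

Lemma poly_top_r : 4/5 <= r -> r <= 1/1 -> 0/1 <= u -> u <= 1/4 ->
  6 * u * r ^+ 2 - 4 * u ^+ 2 * r + u ^+ 3 <= 303/200 * r ^+ 3.
Proof. bernstein 3%N 3%N. Qed.

(** [hA], [hB], [hC] bound the tail [A] from above, [h1] and [h2] bound [X] from below. For small
    [u] the bound [h1] suffices; near [u = 1/4] it is replaced by [h2], except that [h1] and [hC]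
    cover all [u] once [r > 4/5]. *)
Lemma compare_bounds : 1/3 <= r -> r <= 1 -> 0 <= u -> u <= 1/4 -> 0 <= A ->
  A * (1 - 2 * r) * r ^+ 3 <= u ^+ 4 ->
  A * (1 - r) * r ^+ 3 <= 4 * u ^+ 3 * r - 2 * u ^+ 4 ->
  A * r ^+ 3 <= 6 * u ^+ 2 * r ^+ 2 - 4 * u ^+ 3 * r + u ^+ 4 ->
  u + (3/4 * (1 + r) - 4 * u) * A <= X ->
  r ^+ 3 * (2 * u + 2 * (3/4 * (1 + r) - 4 * u) * A - X) <=
    (r - u) ^+ 3 + 3 * Num.max 0 (1 - 2 * r) * u * (r - u) ^+ 2 ->
  A + u / 100 <= X.
Proof.
move=> r0 r1 u0 u1 A0 hA hB hC h1 h2.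
have rp : 0 < r ^+ 3 by apply: exprn_gt0; lra.
(* If this quantity is nonpositive, the coefficient of [A] in [h1] is at least 1 and [h1] alone
   suffices. *)
have [D0|D0] := lerP (1/4 + 4 * u - 3/4 * r) 0; first by nra.
have u0' : 0/1 <= u by lra.
have from_first c : 0 < c -> A * c <= u * c * (99/100) / (1/4 + 4 * u - 3/4 * r) ->
    A + u / 100 <= X.
  move=> c0; rewrite ler_pdivlMr // => h.
  have : A * (1/4 + 4 * u - 3/4 * r) <= u * (99/100).
    by rewrite -(ler_pM2r c0); lra.
  by move: h1; lra.
have first_b : (1/4 + 4 * u - 3/4 * r) * (4 * u ^+ 2 * r - 2 * u ^+ 3)
    <= 99/100 * (1 - r) * r ^+ 3 -> r < 1 -> A + u / 100 <= X.
  move=> P lr1; apply: (from_first ((1 - r) * r ^+ 3)); first by rewrite mulr_gt0 // subr_gt0.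
  rewrite ler_pdivlMr // mulrA.
  apply: (le_trans (ler_wpM2r (ltW D0) hB)).
  by have := ler_wpM2l u0 P; lra.
(* As [4 * u <= 1], the coefficient of [A] to be absorbed is at most [3/2 * (1 - r)], which is what
   [hB] controls. *)
have second_b E : 3/2 * (4 * u ^+ 3 * r - 2 * u ^+ 4) <= 199/100 * u * r ^+ 3 - E ->
    r ^+ 3 * (2 * u + 2 * (3/4 * (1 + r) - 4 * u) * A - X) <= E -> A + u / 100 <= X.
  move=> P hE; rewrite -(ler_pM2l rp).
  have : 0 <= r ^+ 3 * A * (1 - 4 * u) by rewrite !mulr_ge0 ?(ltW rp)//; lra.
  by move: hE P hB; lra.
have [r2|r2] := leP r (9/20).
  have c0 : 0 < 1 - 2 * r by lra.
  have [u2|u2] := leP u (21/100).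
    apply: (from_first ((1 - 2 * r) * r ^+ 3)); first by rewrite mulr_gt0.
    rewrite ler_pdivlMr // mulrA.
    apply: (le_trans (ler_wpM2r (ltW D0) hA)).
    by have := ler_wpM2l u0 (poly_small_r_first r0 r2 u0' u2); lra.
  have := poly_small_r_second r0 r2 (ltW u2) u1; rewrite max_r in h2; last by lra.
  move=> P; rewrite -(ler_pM2l rp) -(ler_pM2l c0).
  have : 0 <= r ^+ 3 * A * (1 - 4 * u) * (1 - 2 * r).
    by rewrite !mulr_ge0 ?(ltW rp) ?(ltW c0)//; lra.
  have := ler_wpM2l (ltW c0) h2.
  have : 3/2 * (1 - r) * (A * (1 - 2 * r) * r ^+ 3) <= 3/2 * (1 - r) * u ^+ 4.
    by apply: ler_wpM2l => //; lra.
  move: P; lra.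
have [r3|r3] := leP r (3/5).
  have [u2|u2] := leP u (21/100).
    by apply: first_b; [exact: poly_middle_r_first (ltW r2) r3 u0' u2 | lra].
  have [r4|r4] := leP r (1/2).
    rewrite max_r in h2; last by lra.
    apply: second_b h2; rewrite opprD addrA.
    by have := poly_below_half_second (ltW r2) r4 (ltW u2) u1; lra.
  rewrite max_l in h2; last by lra.
  by apply: second_b h2; have := poly_above_half_second (ltW r4) r3 (ltW u2) u1; lra.
have [r4|r4] := leP r (4/5).
  have [u2|u2] := leP u (47/200).
    by apply: first_b; [exact: poly_large_r_first (ltW r3) r4 u0' u2 | lra].
  rewrite max_l in h2; last by lra.
  by apply: second_b h2; have := poly_large_r_second (ltW r3) r4 (ltW u2) u1; lra.
have r1' : r <= 1/1 by lra.
apply: (from_first _ rp); rewrite ler_pdivlMr //.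
have := ler_wpM2l u0 (poly_top_r (ltW r4) r1' u0' u1) => P.
(* For [r >= 4/5] and [u <= 1/4] the coefficient is at most [1/4 + 1 - 3/5 = 65/100]. *)
apply: le_trans (_ : A * r ^+ 3 * (65/100) <= _).
  by rewrite ler_wpM2l ?(mulr_ge0 A0 (ltW rp))//; lra.
have : 0 <= u * r ^+ 3 by rewrite mulr_ge0 ?(ltW rp).
by move: hC P; lra.
Qed.
End Numeric.

(** * Averages and the convex order *)

Section Average.
Variables (R : realFieldType) (I : finType).
Implicit Types (f g : I -> R) (c : R).

Definition avg f : R := (\sum_i f i) / #|I|%:R.

Lemma eq_avg f g : f =1 g -> avg f = avg g.
Proof. by move=> fg; rewrite /avg (eq_bigr g). Qed.

Lemma ler_avg f g : (forall i, f i <= g i) -> avg f <= avg g.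
Proof. by move=> fg; rewrite ler_wpM2r ?invr_ge0 ?ler0n // ler_sum. Qed.

Lemma avgD f g : avg (fun i => f i + g i) = avg f + avg g.
Proof. by rewrite /avg big_split mulrDl. Qed.

Lemma avgZ c f : avg (fun i => c * f i) = c * avg f.
Proof. by rewrite /avg -mulr_sumr mulrA. Qed.

Lemma avg_const c : (0 < #|I|)%N -> avg (fun=> c) = c.
Proof.
by move=> I0; rewrite /avg sumr_const -[c *+ _]mulr_natr mulfK // pnatr_eq0 -lt0n.
Qed.

Lemma avg_ge0 f : (forall i, 0 <= f i) -> 0 <= avg f.
Proof. by move=> f0; rewrite mulr_ge0 ?invr_ge0 ?ler0n ?sumr_ge0. Qed.

End Average.

Lemma exchange_avg (R : realFieldType) (I J : finType) (f : I -> J -> R) :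
  avg (fun i => avg (f i)) = avg (fun j => avg (f^~ j)).
Proof. by rewrite /avg -!mulr_suml exchange_big /= -!mulrA [X in _ * X]mulrC. Qed.

Section ConvexOrder.
Variables (R : realFieldType) (I : finType) (V : I -> R) (r : R).
Hypothesis (I0 : (0 < #|I|)%N) (r0 : 0 < r).
Hypothesis (V0 : forall i, 0 <= V i) (Vr : forall i, V i <= r).
Implicit Type phi : R -> R.

(** The expectation of [phi] at [s] plus [k] independent uniform samples of [V]. In [iter_bernoulli]
    each sample is replaced by [r] times a Bernoulli variable with the same mean. *)
Fixpoint iter_avg k phi s : R :=
  if k is k'.+1 then avg (fun i => iter_avg k' phi (s + V i)) else phi s.

Fixpoint iter_bernoulli k phi s : R :=
  if k is k'.+1 then (1 - avg V / r) * iter_bernoulli k' phi s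
                     + avg V / r * iter_bernoulli k' phi (s + r)
  else phi s.

(** Convexity restricted to chords of length [r], the form preserved by [iter_bernoulli]. *)
Definition below_chord phi := forall s v, 0 <= v -> v <= r ->
  phi (s + v) <= (1 - v / r) * phi s + v / r * phi (s + r).

Lemma avg_V_bounds : 0 <= avg V / r /\ avg V / r <= 1.
Proof.
split; first by rewrite divr_ge0 ?avg_ge0 // ltW.
rewrite ler_pdivrMr // mul1r -[leRHS](avg_const (I := I)) //.
exact: ler_avg.
Qed.

Lemma below_chord_iter k phi : below_chord phi -> below_chord (iter_bernoulli k phi).
Proof.
move=> cphi; elim: k => //= k IH s v v0 vr.
have [p0 p1] := avg_V_bounds.
rewrite [s + v + r]addrAC.
have := ler_wpM2l p0 (IH (s + r) v v0 vr).
rewrite -subr_ge0 in p1; have := ler_wpM2l p1 (IH s v v0 vr).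
by move: (avg V / r) (v / r) => p q; lra.
Qed.

(** The variables are replaced one at a time. A chord is affine in [V i], so its average depends on
    [V] only through the mean. *)
Lemma ler_iter k phi s : below_chord phi ->
  iter_avg k phi s <= iter_bernoulli k phi s.
Proof.
move=> cphi; elim: k s => //= k IH s.
apply: le_trans (ler_avg (fun i => IH (s + V i))) _.
have c i := @below_chord_iter k phi cphi s (V i) (V0 i) (Vr i).
apply: le_trans (ler_avg c) _.
rewrite le_eqVlt; apply/orP; left; apply/eqP.
set a := iter_bernoulli _ _ _; set b := iter_bernoulli _ _ _.
transitivity (avg (fun i => a + (b - a) / r * V i)).
  by apply: eq_avg => i; ring.
by rewrite avgD avgZ avg_const //; ring.
Qed.

Lemma ler_iter_avg k phi psi s : (forall x, s <= x -> phi x <= psi x) ->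
  iter_avg k phi s <= iter_avg k psi s.
Proof.
elim: k s => [|k IH] s h /=; first exact: h.
by apply: ler_avg => i; apply: IH => x sx; apply: h; apply: le_trans sx; rewrite lerDl.
Qed.

Lemma iter_avgD k phi psi s :
  iter_avg k (fun x => phi x + psi x) s = iter_avg k phi s + iter_avg k psi s.
Proof.
by elim: k s => //= k IH s; rewrite -avgD; apply: eq_avg => i; rewrite IH.
Qed.

Lemma iter_avgZ k c phi s :
  iter_avg k (fun x => c * phi x) s = c * iter_avg k phi s.
Proof.
by elim: k s => //= k IH s; rewrite -avgZ; apply: eq_avg => i; rewrite IH.
Qed.

Lemma iter_avg_const k c s : iter_avg k (fun=> c) s = c.
Proof.
by elim: k s => //= k IH s; rewrite -[RHS](avg_const (I := I)) //; apply: eq_avg.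
Qed.

Lemma iter_avg_id k s : iter_avg k (fun x => x) s = s + k%:R * avg V.
Proof.
elim: k s => /= [|k IH] s; first by rewrite mul0r addr0.
rewrite -(eq_avg (f := fun i => (s + k%:R * avg V) + V i)).
  by rewrite avgD avg_const // -natr1; ring.
by move=> i; rewrite IH; ring.
Qed.

Lemma below_chord_max c d : below_chord (fun x => Num.max 0 (c * x + d)).
Proof.
move=> s v v0 vr.
have q0 : 0 <= v / r by rewrite divr_ge0 // ltW.
have q1 : 0 <= 1 - v / r by rewrite subr_ge0 ler_pdivrMr // mul1r.
rewrite ge_max; apply/andP; split.
  by rewrite addr_ge0 // mulr_ge0 // le_max lexx.
have -> : c * (s + v) + d = (1 - v / r) * (c * s + d) + v / r * (c * (s + r) + d).
  by field; apply: lt0r_neq0.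
by apply: lerD; apply: ler_wpM2l => //; rewrite le_max lexx orbT.
Qed.

End ConvexOrder.

(** * Tail bounds for sums of bounded variables *)

Section Tail.
Variables (R : realFieldType) (I : finType) (V : I -> R) (r : R).
Hypothesis (I0 : (0 < #|I|)%N) (r0 : 0 < r).
Hypothesis (V0 : forall i, 0 <= V i) (Vr : forall i, V i <= r).

Let u := avg V.
Let tail (x : R) : R := (1 + r <= x)%R%:R.
Let A := iter_avg V 4 tail 0.

Lemma tail_ge0 : 0 <= A.
Proof.
by rewrite -(iter_avg_const V I0 4 0 0); apply: ler_iter_avg.
Qed.

(** A Markov argument: the indicator of the tail times [1 + r - t] lies below the convex function
    [max 0 (x - t)], whose expectation grows under the Bernoulli replacement. *)
Lemma tail_le_max t : t < 1 + r ->
  A * (1 + r - t) <= iter_bernoulli V r 4 (fun x => Num.max 0 (x - t)) 0.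
Proof.
move=> tr; have c0 : 0 < 1 + r - t by rewrite subr_gt0.
rewrite mulrC -iter_avgZ.
apply: le_trans (_ : iter_avg V 4 (fun x => Num.max 0 (1 * x + - t)) 0 <= _).
  apply: ler_iter_avg => // x _; rewrite /tail mul1r.
  have [h|h] := lerP (1 + r) x; rewrite ?mulr1 ?mulr0 le_max ?lexx //.
  by rewrite lerD2r h orbT.
apply: le_trans (ler_iter I0 r0 V0 Vr _ _ (below_chord_max r0 _ _)) _.
by rewrite /= !mul1r.
Qed.

Lemma tail_leV : A * (1 + r) <= 4 * u.
Proof.
rewrite mulrC -iter_avgZ -[4 * u]add0r -[4]/(4%:R) -iter_avg_id //.
apply: ler_iter_avg => // x x0; rewrite /tail.
by case: (lerP (1 + r) x) => h; rewrite ?mulr1 ?mulr0.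
Qed.

(** This bound and the next two take [t] equal to [3r], [2r] and [r], so that only the top one, two
    or three values of the Bernoulli sum contribute. *)
Lemma tail_bound3 : 3 * r < 1 + r -> A * (1 - 2 * r) * r ^+ 3 <= u ^+ 4.
Proof.
have r0' := r0.
move=> h; have := tail_le_max h => /=; rewrite -/u.
rewrite (_ : Num.max 0 (0 - 3 * r) = 0); last by apply: max_l; lra.
rewrite (_ : Num.max 0 (0 + r - 3 * r) = 0); last by apply: max_l; lra.
rewrite (_ : Num.max 0 (0 + r + r - 3 * r) = 0); last by apply: max_l; lra.
rewrite (_ : Num.max 0 (0 + r + r + r - 3 * r) = 0); last by apply: max_l; lra.
rewrite (_ : Num.max 0 (0 + r + r + r + r - 3 * r) = 4%:R * r - 3 * r);
  last by rewrite max_r; [ring | lra].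
have r3 : 0 <= r ^+ 3 by rewrite exprn_ge0 ?ltW.
move/(ler_wpM2r r3); rewrite (_ : 1 + r - 3 * r = 1 - 2 * r); last by ring.
move/le_trans; apply; rewrite le_eqVlt; apply/orP; left; apply/eqP.
by field; apply: lt0r_neq0.
Qed.

Lemma tail_bound2 : 2 * r < 1 + r ->
  A * (1 - r) * r ^+ 3 <= 4 * u ^+ 3 * r - 2 * u ^+ 4.
Proof.
have r0' := r0.
move=> h; have := tail_le_max h => /=; rewrite -/u.
rewrite (_ : Num.max 0 (0 - 2 * r) = 0); last by apply: max_l; lra.
rewrite (_ : Num.max 0 (0 + r - 2 * r) = 0); last by apply: max_l; lra.
rewrite (_ : Num.max 0 (0 + r + r - 2 * r) = 0); last by apply: max_l; lra.
rewrite (_ : Num.max 0 (0 + r + r + r - 2 * r) = 3%:R * r - 2 * r);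
  last by rewrite max_r; [ring | lra].
rewrite (_ : Num.max 0 (0 + r + r + r + r - 2 * r) = 4%:R * r - 2 * r);
  last by rewrite max_r; [ring | lra].
have r3 : 0 <= r ^+ 3 by rewrite exprn_ge0 ?ltW.
move/(ler_wpM2r r3); rewrite (_ : 1 + r - 2 * r = 1 - r); last by ring.
move/le_trans; apply; rewrite le_eqVlt; apply/orP; left; apply/eqP.
by field; apply: lt0r_neq0.
Qed.

Lemma tail_bound1 :
  A * r ^+ 3 <= 6 * u ^+ 2 * r ^+ 2 - 4 * u ^+ 3 * r + u ^+ 4.
Proof.
have r0' := r0.
have h : r < 1 + r by lra.
have := tail_le_max h => /=; rewrite -/u.
rewrite (_ : Num.max 0 (0 - r) = 0); last by apply: max_l; lra.
rewrite (_ : Num.max 0 (0 + r - r) = 0); last by apply: max_l; lra.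
rewrite (_ : Num.max 0 (0 + r + r - r) = 2%:R * r - r);
  last by rewrite max_r; [ring | lra].
rewrite (_ : Num.max 0 (0 + r + r + r - r) = 3%:R * r - r);
  last by rewrite max_r; [ring | lra].
rewrite (_ : Num.max 0 (0 + r + r + r + r - r) = 4%:R * r - r);
  last by rewrite max_r; [ring | lra].
have r3 : 0 <= r ^+ 3 by rewrite exprn_ge0 ?ltW.
move/(ler_wpM2r r3); rewrite (_ : 1 + r - r = 1) ?mulr1; last by ring.
move/le_trans; apply; rewrite le_eqVlt; apply/orP; left; apply/eqP.
by field; apply: lt0r_neq0.
Qed.

(** Bernoulli replacement for the convex function [max 0 (1 - 2x)]; [r >= 1/3] makes it vanish at
    [2r] and [3r]. *)
Lemma low_bound : 1 / 3 <= r ->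
  r ^+ 3 * iter_avg V 3 (fun x => Num.max 0 (1 - 2 * x)) 0 <=
    (r - u) ^+ 3 + 3 * Num.max 0 (1 - 2 * r) * u * (r - u) ^+ 2.
Proof.
have r0' := r0.
move=> r13.
have r3 : 0 <= r ^+ 3 by rewrite exprn_ge0 ?ltW.
have -> : iter_avg V 3 (fun x => Num.max 0 (1 - 2 * x)) 0 =
          iter_avg V 3 (fun x => Num.max 0 (- 2 * x + 1)) 0.
  by apply/eqP; rewrite eq_le; apply/andP; split; apply: ler_iter_avg => // x _;
     rewrite mulNr addrC.
apply: le_trans (ler_wpM2l r3 (ler_iter I0 r0 V0 Vr _ _ (below_chord_max r0 _ _))) _.
rewrite /= -/u.
rewrite (_ : Num.max 0 (-2 * 0 + 1) = 1); last by rewrite max_r; lra.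
rewrite (_ : Num.max 0 (-2 * (0 + r) + 1) = Num.max 0 (1 - 2 * r)); last by congr Num.max; ring.
rewrite (_ : Num.max 0 (-2 * (0 + r + r) + 1) = 0); last by apply: max_l; lra.
rewrite (_ : Num.max 0 (-2 * (0 + r + r + r) + 1) = 0); last by apply: max_l; lra.
rewrite le_eqVlt; apply/orP; left; apply/eqP.
by field; apply: lt0r_neq0.
Qed.

(* The four variables play symmetric roles in the event, so that the sum of
   any three of them contributes 3/4 of the total. *)
Lemma excess_bound M :
  (3 / 4 * (1 + r) - M) * A <= iter_avg V 3 (fun x => Num.max 0 (x - M)) 0.
Proof.
pose t a b c d : R := tail (0 + V a + V b + V c + V d).
pose T f : R := avg (fun a => avg (fun b => avg (fun c => avg (fun d => t a b c d * f a b c d)))).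
have TD f g : T (fun a b c d => f a b c d + g a b c d) = T f + T g.
  rewrite /T -avgD; apply: eq_avg => a; rewrite -avgD; apply: eq_avg => b.
  by rewrite -avgD; apply: eq_avg => c; rewrite -avgD; apply: eq_avg => d; ring.
have TZ k f : T (fun a b c d => k * f a b c d) = k * T f.
  rewrite /T -avgZ; apply: eq_avg => a; rewrite -avgZ; apply: eq_avg => b.
  by rewrite -avgZ; apply: eq_avg => c; rewrite -avgZ; apply: eq_avg => d; ring.
have swap12 : T (fun a _ _ _ => V a) = T (fun _ b _ _ => V b).
  rewrite /T exchange_avg; apply: eq_avg => a; apply: eq_avg => b.
  apply: eq_avg => c; apply: eq_avg => d; congr (tail _ * _); ring.
have swap23 : T (fun _ b _ _ => V b) = T (fun _ _ c _ => V c).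
  rewrite /T; apply: eq_avg => a; rewrite exchange_avg; apply: eq_avg => b.
  apply: eq_avg => c; apply: eq_avg => d; congr (tail _ * _); ring.
have swap34 : T (fun _ _ c _ => V c) = T (fun _ _ _ d => V d).
  rewrite /T; apply: eq_avg => a; apply: eq_avg => b.
  rewrite exchange_avg; apply: eq_avg => c; apply: eq_avg => d.
  congr (tail _ * _); ring.
have A_T : A = T (fun _ _ _ _ => 1).
  rewrite /A /T /=; apply: eq_avg => a; apply: eq_avg => b.
  by apply: eq_avg => c; apply: eq_avg => d; rewrite mulr1.
have sum4 : (1 + r) * A <= 4 * T (fun _ _ _ d => V d).
  have -> : 4 * T (fun _ _ _ d => V d) = T (fun a b c d => V a + V b + V c + V d).
    by rewrite !TD swap12 swap23 swap34; ring.
  rewrite A_T -TZ /T; do 4! (apply: ler_avg => ?).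
  rewrite /t /tail; case: (lerP (1 + r) _) => h; rewrite ?(mulr0n, mulr1n, mul0r, mulr0) //.
  by rewrite !mul1r ?mulr1 (le_trans h) // add0r.
apply: le_trans (_ : T (fun a b c _ => V a + V b + V c + - M * 1) <= _).
  by rewrite !TD TZ -A_T swap12 swap23 swap34; lra.
rewrite /T /=; do 3! (apply: ler_avg => ?).
rewrite -[leRHS](avg_const (I := I)) //; apply: ler_avg => d.
rewrite /t /tail add0r mulr1;
by case: (lerP (1 + r) _) => h; rewrite ?(mulr0n, mulr1n) ?mul1r ?mul0r le_max ?lexx ?orbT.
Qed.

(** [g s] abstracts four times the proportion of tops compatible with a bottom sum [s], normalised
    by the number of bottoms. Averaging the two lower bounds on [g] gives the hypotheses [h1] and
    [h2] of [compare_bounds]. *)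
Lemma three_vs_four (g : R -> R) : r <= 1 -> u <= 1 / 4 ->
  (forall s : R, 0 <= s -> Num.max 0 (4 * u - s) <= g s) ->
  (forall s : R, 0 <= s ->
    8 * u - 2 * s - Num.max 0 (1 - 2 * s) + 2 * Num.max 0 (s - 4 * u) <= g s) ->
  401 / 400 * A <= iter_avg V 3 g 0.
Proof.
have r0' := r0.
move=> r1 u1 g1 g2.
have A0 := tail_ge0.
have u0 : 0 <= u by apply: avg_ge0.
have AV := tail_leV.
have [r13|r13] := leP (1 / 3) r; last first.
  (* Four values of at most [r] cannot reach [1 + r]; formally, [t = 4r] makes the Bernoulli
     expectation vanish. *)
  have -> : A = 0.
    apply/eqP; rewrite eq_le A0 andbT.
    have h : 4 * r < 1 + r by lra.
    rewrite -(pmulr_lle0 _ (_ : 0 < 1 + r - 4 * r)); last by lra.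
    apply: le_trans (tail_le_max h) _ => /=.
    by rewrite !max_l ?(mulr0, addr0) //; lra.
  rewrite mulr0 -[leLHS](iter_avg_const V I0 3 0 0); apply: ler_iter_avg => // s s0.
  by apply: le_trans (g1 s s0); rewrite le_max lexx.
have val1 : u + (3 / 4 * (1 + r) - 4 * u) * A <= iter_avg V 3 g 0.
  (* Here [max 0 (4u - x)] is written as [4u - x + max 0 (x - 4u)]: the linear part averages to [u],
     and [excess_bound] handles the rest. *)
  apply: le_trans (_ : iter_avg V 3 (fun x => 4 * u + - 1 * x + Num.max 0 (x - 4 * u)) 0 <= _).
    rewrite !iter_avgD (iter_avgZ V 3 (-1) (fun x => x)) iter_avg_const // iter_avg_id // -/u.
    by have := excess_bound (4 * u); lra.
  apply: ler_iter_avg => // s s0; apply: le_trans (g1 s s0).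
  by rewrite !maxEle; case: ifP; case: ifP; lra.
have val2 : r ^+ 3 * (2 * u + 2 * (3 / 4 * (1 + r) - 4 * u) * A - iter_avg V 3 g 0)
    <= (r - u) ^+ 3 + 3 * Num.max 0 (1 - 2 * r) * u * (r - u) ^+ 2.
  apply: le_trans (low_bound r13); apply: ler_wpM2l; first by rewrite exprn_ge0 ?ltW.
  rewrite lerBlDr -iter_avgD.
  apply: le_trans (_ : iter_avg V 3 (fun x => 8 * u + - 2 * x + 2 * Num.max 0 (x - 4 * u)) 0 <= _).
    rewrite !iter_avgD (iter_avgZ V 3 2 (fun x => Num.max 0 (x - 4 * u))).
    rewrite (iter_avgZ V 3 (-2) (fun x => x)).
    rewrite !iter_avg_const // iter_avg_id // -/u.
    by have := excess_bound (4 * u); lra.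
  by apply: ler_iter_avg => // s s0; have := g2 s s0; lra.
(* Since [A * (1 + r) <= 4 * u], the slack [u / 100] is at least [A / 400]. *)
suff : A + u / 100 <= iter_avg V 3 g 0.
  have : 0 <= A * r by apply: mulr_ge0 => //; apply: ltW.
  by move: AV; lra.
have hA : A * (1 - 2 * r) * r ^+ 3 <= u ^+ 4.
  have [h|h] := ltP (2 * r) 1; first by apply: tail_bound3; lra.
  apply: (@le_trans _ _ 0); last by rewrite exprn_ge0.
  by rewrite pmulr_lle0 ?exprn_gt0 // mulr_ge0_le0 //; lra.
have hB : A * (1 - r) * r ^+ 3 <= 4 * u ^+ 3 * r - 2 * u ^+ 4.
  have [h|h] := ltP r 1; first by apply: tail_bound2; lra.
  rewrite (_ : r = 1); last by lra.
  rewrite subrr mulr0 mul0r mulr1.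
  have : 0 <= u ^+ 3 * (2 - u) by rewrite mulr_ge0 ?exprn_ge0 //; lra.
  by move=> ?; lra.
exact: compare_bounds hA hB tail_bound1 val1 val2.
Qed.
End Tail.

(** * Comparing heavy quadruples with light ones *)

Section Tops.
Variables (R : realFieldType) (J : finType) (Z : J -> R) (N u : R).
Hypotheses (N0 : 0 < N) (Z1 : forall j, Z j <= 1).
Hypotheses (JN : 4 * #|J|%:R <= N) (uZ : u * N <= \sum_j Z j).

Definition topmass (s : R) : R := 4 / N * \sum_j (s < Z j)%R%:R.

(** A linear minorant of the indicator is summed over the tops; the constant term costs at most [b]
    because [4 * #|J| <= N]. *)
Lemma topmass_ge a b s : 0 <= a -> 0 <= b -> (forall j, a * Z j - b <= (s < Z j)%R%:R) ->
  4 * a * u - b <= topmass s.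
Proof.
move=> a0 b0 h; have N0' := N0.
have c0 : 0 <= 4 / N by apply: divr_ge0 => //; apply: ltW.
apply: le_trans (_ : 4 / N * \sum_j (a * Z j - b) <= _); last first.
  by apply: ler_wpM2l => //; apply: ler_sum => j _.
rewrite sumrB -mulr_sumr sumr_const -[b *+ _]mulr_natr.
have h1 : 4 / N * (a * (u * N)) <= 4 / N * (a * \sum_j Z j).
  by apply: ler_wpM2l => //; apply: ler_wpM2l.
have h2 : b * (4 * #|J|%:R) / N <= b.
  by rewrite ler_pdivrMr // ler_wpM2l.
have -> : 4 * a * u = 4 / N * (a * (u * N)) by field; apply: lt0r_neq0.
by move: h1 h2; lra.
Qed.

Lemma topmass_ge0 s : 0 <= topmass s.
Proof.
rewrite mulr_ge0 ?sumr_ge0 // ?divr_ge0 ?(ltW N0) // => j _; exact: ler0n.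
Qed.

Lemma topmass_ge1 (s : R) : 0 <= s -> Num.max 0 (4 * u - s) <= topmass s.
Proof.
move=> s0; rewrite ge_max topmass_ge0 /= -[4 * u](_ : 4 * 1 * u = _); last by ring.
apply: topmass_ge => // j; rewrite mul1r.
by case: ltP => h; rewrite ?mulr1n ?mulr0n; have := Z1 j; lra.
Qed.

(** The minorant is [2 Z - max(2s, 1)], valid since [Z <= 1], with [max(2s, 1)] written as
    [2s + max 0 (1 - 2s)]. For [s > 4u] the claimed bound is nonpositive. *)
Lemma topmass_ge2 (s : R) : 0 <= s ->
  8 * u - 2 * s - Num.max 0 (1 - 2 * s) + 2 * Num.max 0 (s - 4 * u) <= topmass s.
Proof.
move=> s0; have [h|h] := leP s (4 * u); last first.
  apply: le_trans (topmass_ge0 s).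
  rewrite [Num.max 0 (s - _)]max_r; last by lra.
  have : 0 <= Num.max 0 (1 - 2 * s) by rewrite le_max lexx.
  by move: h; lra.
rewrite [Num.max 0 (s - _)]max_l ?mulr0 ?addr0; last by lra.
rewrite -addrA -opprD -[8 * u](_ : 4 * 2 * u = _); last by ring.
have m0 : 0 <= Num.max 0 (1 - 2 * s) by rewrite le_max lexx.
have m1 : 1 - 2 * s <= Num.max 0 (1 - 2 * s) by rewrite le_max lexx orbT.
apply: topmass_ge => // [|j]; first lra.
by case: ltP => hj; rewrite ?mulr1n ?mulr0n; have := Z1 j; lra.
Qed.

End Tops.

(** For [y > 1]: if some [x] is at least 1, the other three sum to at least 1 because that [x] is at
    most [y], and they still do after capping. *)
Lemma capped_tail (R : realFieldType) (x1 x2 x3 x4 y : R) :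
  0 <= x1 -> 0 <= x2 -> 0 <= x3 -> 0 <= x4 ->
  x1 <= y -> x2 <= y -> x3 <= y -> x4 <= y -> 1 + y <= x1 + x2 + x3 + x4 ->
  1 + Num.min y 1 <= 0 + Num.min x1 1 + Num.min x2 1 + Num.min x3 1 + Num.min x4 1.
Proof. by move=> *; rewrite !minEle; do ![case: ifP]; lra. Qed.

Section Weights.
Variables (R : realFieldType) (I J : finType) (W : I -> R) (w : J -> R) (theta : R).

Lemma sum_avg (f : I -> R) : \sum_i f i = #|I|%:R * avg f.
Proof.
have [I0|I0] := posnP #|I|.
  by rewrite I0 mul0r big1 // => i _; have := fintype0 i I0.
by rewrite /avg mulrC divfK // pnatr_eq0 -lt0n.
Qed.

(** [I] indexes the bottoms and [J] the tops. In the degenerate cases all [W] vanish and no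
    quadruple is heavy; otherwise dividing by [1 - theta] reduces to [three_vs_four]. The factor
    [4 / N] in [topmass] turns 401/400 into 401/1600. *)
Lemma weights_compare :
  (forall i, 0 <= W i) -> (forall i, W i <= theta) ->
  (forall j, theta <= w j) -> (forall j, w j <= 1) ->
  (4 * #|J| <= #|I|)%N -> \sum_i W i + \sum_j w j <= #|J|%:R ->
  401 * (\sum_a \sum_b \sum_c \sum_d (1 <= W a + W b + W c + W d)%R%:R) <=
  1600 * (\sum_a \sum_b \sum_c \sum_j (W a + W b + W c + w j < 1)%R%:R) :> R.
Proof.
move=> W0 Wt tw w1 JI sumW.
have RHS0 : 0 <= \sum_a \sum_b \sum_c \sum_j (W a + W b + W c + w j < 1)%R%:R :> R.
  by do 4! (apply: sumr_ge0 => ? _).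
have zero : (forall i, W i = 0) ->
  401 * (\sum_a \sum_b \sum_c \sum_d (1 <= W a + W b + W c + W d)%R%:R) <=
  1600 * (\sum_a \sum_b \sum_c \sum_j (W a + W b + W c + w j < 1)%R%:R) :> R.
  move=> W00; rewrite big1 ?mulr0 ?mulr_ge0 // => a _; rewrite big1 // => b _.
  by rewrite big1 // => c _; rewrite big1 // => d _; rewrite !W00 !addr0 ler10.
have [I0|I0] := posnP #|I|; first by apply: zero => i; have := fintype0 i I0.
have [t0|t0] := leP theta 0.
  by apply: zero => i; apply/eqP; rewrite eq_le W0 (le_trans (Wt i)).
have sumZ : \sum_i W i <= \sum_j (1 - w j).
  by rewrite sumrB sumr_const lerBrDr.
have [t1|t1] := leP 1 theta.
  apply: zero => i; apply/eqP; rewrite eq_le W0 andbT.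
  apply: le_trans (_ : \sum_i W i <= 0).
    by rewrite (bigD1 i) //= lerDl sumr_ge0.
  apply: le_trans sumZ _; rewrite big1 // => j _; apply/eqP.
  by rewrite subr_eq0 eq_sym eq_le w1 (le_trans t1).
pose tau := 1 - theta; have tau0 : 0 < tau by rewrite subr_gt0.
pose r := Num.min (theta / tau) 1; pose V i := Num.min (W i / tau) 1.
pose Z j := (1 - w j) / tau; pose N : R := #|I|%:R.
have N0 : 0 < N by rewrite ltr0n.
have r0 : 0 < r by rewrite lt_min ltr01 divr_gt0.
have r1 : r <= 1 by rewrite ge_min lexx orbT.
have V0 i : 0 <= V i by rewrite le_min ler01 andbT divr_ge0 ?(ltW tau0).
have Vr i : V i <= r.
  by rewrite le_min !ge_min lexx orbT andbT ler_wpM2r // invr_ge0 ltW.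
have Z1 j : Z j <= 1 by rewrite ler_pdivrMr // mul1r lerD2l lerN2.
have JN : 4 * #|J|%:R <= N by rewrite -natrM ler_nat.
have uZ : avg V * N <= \sum_j Z j.
  rewrite mulrC -sum_avg -mulr_suml ler_pdivlMr // mulr_suml.
  apply: le_trans sumZ; apply: ler_sum => i _.
  by rewrite -ler_pdivlMr // ge_min lexx.
have u4 : avg V <= 1 / 4.
  have : \sum_j Z j <= #|J|%:R.
    by rewrite -sum1_card natr_sum; apply: ler_sum => j _; rewrite mulr1n.
  by move=> hZ; rewrite -(ler_pM2r N0); move: hZ uZ JN; lra.
have := three_vs_four I0 r0 V0 Vr r1 u4 (topmass_ge1 N0 Z1 JN uZ)
  (topmass_ge2 N0 Z1 JN uZ).
have tailP a b c d : ((1 <= W a + W b + W c + W d)%R%:R : R) <=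
    (1 + r <= 0 + V a + V b + V c + V d)%R%:R.
  have [h|h] := lerP 1 (W a + W b + W c + W d); last exact: ler0n.
  suff -> : 1 + r <= 0 + V a + V b + V c + V d by [].
  have {h} : 1 + theta / tau <= W a / tau + W b / tau + W c / tau + W d / tau.
    rewrite -!mulrDl -[X in X + _](divff (lt0r_neq0 tau0)) -mulrDl subrK.
    by rewrite ler_wpM2r // invr_ge0 ltW.
  have q i : W i / tau <= theta / tau by rewrite ler_wpM2r // invr_ge0 ltW.
  have q0 i : 0 <= W i / tau by rewrite divr_ge0 ?(ltW tau0).
  move: (q0 a) (q0 b) (q0 c) (q0 d) (q a) (q b) (q c) (q d).
  rewrite /r /V; move: (W a / tau) (W b / tau) (W c / tau) (W d / tau) (theta / tau).
  by move=> *; apply: capped_tail.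
have massP a b c : topmass Z N (0 + V a + V b + V c) <=
    4 / N * \sum_j (W a + W b + W c + w j < 1)%R%:R.
  apply: ler_wpM2l; first by rewrite divr_ge0 // ltW.
  apply: ler_sum => j _.
  have [h|h] := ltP (0 + V a + V b + V c) (Z j); last exact: ler0n.
  suff -> : W a + W b + W c + w j < 1 by [].
  (* The sum of the three [V] is below [Z j <= 1], so no cap is active and the inequality can be
     scaled back to [W]. *)
  have VW i : V i <= 0 + V a + V b + V c -> W i = tau * V i.
    move=> hi; have : V i < 1 by apply: le_lt_trans hi (lt_le_trans h (Z1 j)).
    rewrite /V minEle; case: ifP => _; last by rewrite ltxx.
    by rewrite [RHS]mulrC divfK // lt0r_neq0.
  have := V0 a; have := V0 b; have := V0 c => c0 b0 a0.
  rewrite (VW a) ?(VW b) ?(VW c); try lra.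
  move: h; rewrite -(ltr_pM2l tau0) (_ : tau * Z j = 1 - w j); last first.
    by rewrite /Z [LHS]mulrC divfK ?lt0r_neq0.
  by lra.
set A := iter_avg _ _ _ _; set B := iter_avg _ _ _ _ => AB.
have avg_up k (f g : I -> R) :
  (forall a, f a <= N ^+ k * g a) -> \sum_a f a <= N ^+ k.+1 * avg g.
  by move=> fg; rewrite exprS -mulrA -avgZ -sum_avg; apply: ler_sum => a _.
have avg_down k (f g : I -> R) :
  (forall a, N ^+ k * g a <= f a) -> N ^+ k.+1 * avg g <= \sum_a f a.
  by move=> fg; rewrite exprS -mulrA -avgZ -sum_avg; apply: ler_sum => a _.
have hA : \sum_a \sum_b \sum_c \sum_d (1 <= W a + W b + W c + W d)%R%:R <= N ^+ 4 * A.
  rewrite /A /=; do 4! (apply: (avg_up) => ?).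
  by rewrite expr0 mul1r.
have hB : N ^+ 3 * B <=
    \sum_a \sum_b \sum_c (4 / N * \sum_j (W a + W b + W c + w j < 1)%R%:R).
  rewrite /B /=; do 3! (apply: (avg_down) => ?).
  by rewrite expr0 mul1r; apply: massP.
move: hB; under eq_bigr do under eq_bigr do rewrite -mulr_sumr.
under eq_bigr do rewrite -mulr_sumr.
rewrite -mulr_sumr => hB.
have {}hB := ler_wpM2l (ltW N0) hB.
rewrite mulrA -exprS [leRHS]mulrA [N * (4 / N)]mulrC divfK ?lt0r_neq0 // in hB.
have := ler_wpM2l (exprn_ge0 4 (ltW N0)) AB; move: hA hB.
by move: (N ^+ 4) => N4; lra.
Qed.
End Weights.

(** * Approximate fractional covers *)

Section Multiplicative.
Variables (R : realType) (n m L : nat) (G : {set {set 'I_n}}).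
Implicit Types (t : {ffun 'I_4 -> 'I_L}) (ts : seq {ffun 'I_4 -> 'I_L}).

Definition potential (q : R) ts : R := \sum_(I < L) q ^+ load ts I.

(** Convexity of the exponential in [k]: on [[0, 4]] it lies below its chord. The interval reaches 4
    because a type may use one block four times. *)
Lemma expr_le_chord4 (q : R) (k : nat) : 1 <= q -> (k <= 4)%N ->
  q ^+ k <= 1 + k%:R * ((q ^+ 4 - 1) / 4).
Proof.
move=> q1; case: k => [|[|[|[|[|//]]]]] _; rewrite ?expr0; try lra.
- rewrite expr1; have : 0 <= (q - 1) ^+ 2 * (q ^+ 2 + 2 * q + 3).
    by rewrite mulr_ge0 ?sqr_ge0 //; nra.
  by lra.
- have : 0 <= (q ^+ 2 - 1) ^+ 2 by rewrite sqr_ge0.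
  by lra.
- have : 0 <= (q - 1) ^+ 2 * (3 * q ^+ 2 + 2 * q + 1).
    by rewrite mulr_ge0 ?sqr_ge0 //; nra.
  by lra.
Qed.

Lemma mult_le4 t I : (mult t I <= 4)%N.
Proof.
rewrite /mult; apply: leq_trans (_ : \sum_(i < 4) 1 <= 4)%N.
  by apply: leq_sum => i _; case: eqP.
by rewrite sum1_card card_ord.
Qed.

Lemma potential_cons q t ts : 1 <= q ->
  potential q (t :: ts) <=
    potential q ts + (q ^+ 4 - 1) / 4 * \sum_(i < 4) q ^+ load ts (t i).
Proof.
move=> q1.
have -> : \sum_(i < 4) q ^+ load ts (t i) =
    \sum_(I < L) q ^+ load ts I * (mult t I)%:R.
  under [RHS]eq_bigr do rewrite /mult natr_sum mulr_sumr.
  rewrite exchange_big; apply: eq_bigr => i _.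
  rewrite (bigD1 (t i)) //= eqxx mulr1 big1 ?addr0 // => I It.
  by rewrite eq_sym (negbTE It) mulr0.
rewrite mulr_sumr -big_split; apply: ler_sum => I _ /=.
rewrite /load big_cons exprD -/(load ts I).
have q0 : 0 <= q ^+ load ts I by apply: exprn_ge0; lra.
have := ler_wpM2r q0 (expr_le_chord4 q1 (mult_le4 t I)).
by lra.
Qed.

(** Multiplicative weights: give block [I] a weight proportional to [q ^+ load ts I], with total
    [S]. An uncovered type has weight below 1, so adding it multiplies the potential by at most
    [1 + (q ^+ 4 - 1) / 4 / S]. *)
Lemma greedy_types (q S : R) : 1 <= q -> 0 < S ->
  (forall w : 'I_L -> R, (forall I, 0 <= w I) -> \sum_I w I <= S ->
     exists2 t, edge_above m G t & \sum_(i < 4) w (t i) < 1) ->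
  forall K, exists ts, [/\ size ts = K, {in ts, forall t, edge_above m G t} &
    potential q ts <= L%:R * (1 + (q ^+ 4 - 1) / 4 / S) ^+ K].
Proof.
move=> q1 S0 uncovered; elim=> [|K [ts [szts above pot]]].
  exists [::]; split => //; rewrite expr0 mulr1 /potential.
  under eq_bigr do rewrite /load big_nil expr0.
  by rewrite sumr_const card_ord.
have q40 : 0 <= (q ^+ 4 - 1) / 4.
  have : 1 <= q ^+ 4 by rewrite exprn_ege1.
  by lra.
have [L0|L0] := posnP L.
  have [||t _ _] := uncovered (fun=> 0); rewrite ?big1 ?(ltW S0) //.
  by have := leq_trans (ltn_ord (t ord0)) (eq_leq L0).
have pot0 : 0 < potential q ts.
  rewrite /potential (bigD1 (Ordinal L0)) //= ltr_wpDr ?exprn_gt0 //; last lra.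
  by apply: sumr_ge0 => I _; rewrite exprn_ge0 //; lra.
have [I||t ta tw] := uncovered (fun I => S / potential q ts * q ^+ load ts I).
- by rewrite mulr_ge0 ?divr_ge0 ?exprn_ge0 ?ltW //; lra.
- by rewrite -mulr_sumr divfK // lt0r_neq0.
exists (t :: ts); split => /=; first by rewrite szts.
  by move=> t'; rewrite inE => /predU1P[->//|/above].
apply: le_trans (potential_cons _ _ q1) _.
rewrite [(1 + _) ^+ K.+1]exprSr mulrA.
apply: le_trans (_ : potential q ts * (1 + (q ^+ 4 - 1) / 4 / S) <= _).
  rewrite mulrDr mulr1 lerD2l [leRHS]mulrCA; apply: ler_wpM2l => //.
  rewrite -mulr_sumr mulrAC ltr_pdivrMr // mul1r in tw.
  by rewrite ler_pdivlMr // mulrC ltW.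
by apply: ler_wpM2r => //; rewrite addr_ge0 // divr_ge0 // ltW.
Qed.

(** Without such a cover the greedy process yields [s.+1] types of potential below [q ^+ m.+1]. Then
    no load exceeds [m], and [matching_of_types] contradicts the matching number. *)
Lemma fractional_cover (q : R) (s : nat) :
  (0 < m)%N -> (m * L <= n)%N -> 1 < q ->
  L%:R < 1 + m%:R * ((q - 1) / q) ^+ 2 ->
  is_kgraph 4 G -> is_stable 4 G -> (matching_number G <= s)%N ->
  exists w : 'I_L -> R, [/\ forall I, 0 <= w I,
    \sum_I w I <= s.+1%:R * q ^+ 5 / m%:R &
    forall t, edge_above m G t -> 1 <= \sum_(i < 4) w (t i)].
Proof.
move=> m0 mLn q1 Lsmall Gk Gst nuG; apply: boolp.contrapT => nocover.
have q0 : 0 < q by apply: lt_trans q1.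
have mR : 0 < m%:R :> R by rewrite ltr0n.
pose S : R := s.+1%:R * q ^+ 5 / m%:R.
have S0 : 0 < S by rewrite divr_gt0 // mulr_gt0 // exprn_gt0.
have uncovered (w : 'I_L -> R) : (forall I, 0 <= w I) -> \sum_I w I <= S ->
    exists2 t, edge_above m G t & \sum_(i < 4) w (t i) < 1.
  move=> w0 wS; apply: boolp.contrapT => h; apply: nocover; exists w; split=> // t ta.
  by rewrite leNgt; apply/negP => tw; apply: h; exists t.
have [ts [szts above pot]] := greedy_types (ltW q1) S0 uncovered s.+1.
have qexp : expR ((q - 1) / q) <= q.
  rewrite -lef_pV2 ?posrE ?expR_gt0 // -expRN.
  apply: le_trans (expR_ge1Dx _); rewrite le_eqVlt; apply/orP; left; apply/eqP.
  by field; apply: lt0r_neq0.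
have potlt : potential q ts < q ^+ m.+1.
  apply: le_lt_trans pot _.
  (* The [s.+1] rounds contribute at most [expR x], and the initial potential [L] is below
     [expR (m * ((q - 1) / q) ^ 2)]. The exponents add up to [m * (q - 1) / q], and
     [expR ((q - 1) / q) <= q]. *)
  set x := m%:R * ((q - 1) / q ^+ 2).
  have g0 : 0 <= (q ^+ 4 - 1) / 4 / S.
    have := exprn_ege1 4 (ltW q1) => q41.
    by apply: divr_ge0 (ltW S0); lra.
  have h1 : (1 + (q ^+ 4 - 1) / 4 / S) ^+ s.+1 <= expR x.
    apply: le_trans (_ : expR ((q ^+ 4 - 1) / 4 / S) ^+ s.+1 <= _).
      by rewrite lerXn2r ?nnegrE ?expR_ge0 ?addr_ge0 // expR_ge1Dx.
    rewrite -expRM_natl ler_expR.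
    have -> : s.+1%:R * ((q ^+ 4 - 1) / 4 / S) = m%:R * ((q ^+ 4 - 1) / 4 / q ^+ 5).
      by rewrite /S; field; rewrite !lt0r_neq0 // ltr_wpDr // ler0n.
    rewrite /x; apply: ler_wpM2l; first exact: ltW.
    rewrite ler_pdivlMr ?exprn_gt0 // mulrAC ler_pdivrMr ?exprn_gt0 //.
    have : 0 <= q ^+ 2 * (q - 1) ^+ 2 * (3 * q ^+ 2 + 2 * q + 1).
      by rewrite !mulr_ge0 ?sqr_ge0 //; nra.
    by lra.
  have h2 : L%:R < expR (m%:R * ((q - 1) / q) ^+ 2).
    exact: lt_le_trans Lsmall (expR_ge1Dx _).
  have h3 : expR (m%:R * ((q - 1) / q) ^+ 2) * expR x <= q ^+ m.
    rewrite -expRD.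
    have -> : m%:R * ((q - 1) / q) ^+ 2 + x = m%:R * ((q - 1) / q).
      by rewrite /x; field; rewrite lt0r_neq0.
    by rewrite expRM_natl lerXn2r ?nnegrE ?expR_ge0 ?(ltW q0).
  apply: le_lt_trans (_ : L%:R * expR x < _); first by apply: ler_wpM2l.
  apply: lt_le_trans (_ : expR (m%:R * ((q - 1) / q) ^+ 2) * expR x <= _).
    by rewrite ltr_pM2r ?expR_gt0.
  by apply: le_trans h3 _; rewrite exprS ler_peMl ?exprn_ge0 ?(ltW q0) ?(ltW q1).
have ld I : (load ts I <= m)%N.
  rewrite leqNgt; apply/negP => mI; move: potlt; rewrite ltNge => /negP; apply.
  apply: le_trans (_ : q ^+ load ts I <= _); first by rewrite ler_weXn2l // ltW.
  rewrite /potential (bigD1 I) //= lerDl sumr_ge0 // => J _.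
  by rewrite exprn_ge0 // ltW.
have [M [MG trM cM _]] := matching_of_types mLn Gk Gst above ld.
have : (#|M| <= matching_number G)%N.
  by apply: (leq_bigmax_cond (F := fun M : {set {set 'I_n}} => #|M|)); rewrite MG.
by rewrite cM szts leqNgt ltnS nuG.
Qed.
End Multiplicative.

Lemma edge_enum (n k : nat) (e : {set 'I_n}) : #|e| = k ->
  exists2 a : 'I_k -> 'I_n, injective a & e = [set a i | i : 'I_k].
Proof.
move=> ek; exists (fun i => enum_val (cast_ord (esym ek) i)).
  by move=> i j /enum_val_inj /cast_ord_inj.
apply/setP => v; apply/idP/imsetP => [ve|[i _ ->]]; last exact: enum_valP.
exists (cast_ord ek (enum_rank_in ve v)) => //.
by rewrite cast_ordK enum_rankK_in.
Qed.

(** * From block weights to monotone vertex weights *)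

Section VertexWeights.
Variables (R : realType) (n m : nat) (G : {set {set 'I_n}}).
Variable w : 'I_(n %/ m) -> R.
Hypotheses (m0 : (0 < m)%N) (w0 : forall I, 0 <= w I).

(* Replacing the weight of a block by the least weight found so far makes the
   weight monotone, and keeps it a cover since the types in [edge_above] are
   closed under decreasing block indices. *)
Definition vertex_weight (v : nat) : R :=
  if (v < n)%N then \big[Num.min/1]_(I < n %/ m | (I < v %/ m)%N) w I else 0.

Lemma vertex_weight_ge0 v : 0 <= vertex_weight v.
Proof.
rewrite /vertex_weight; case: ifP => // _.
by apply: le_bigmin => // I _; apply: w0.
Qed.

Lemma vertex_weight_le1 v : vertex_weight v <= 1.
Proof.
rewrite /vertex_weight; case: ifP => // _; exact: bigmin_le_id.
Qed.

Lemma vertex_weight_anti x y : (x <= y)%N -> vertex_weight y <= vertex_weight x.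
Proof.
move=> xy; have [yn|yn] := boolP (y < n)%N; last first.
  by rewrite {1}/vertex_weight (negbTE yn) vertex_weight_ge0.
rewrite /vertex_weight yn (leq_ltn_trans xy yn).
apply: le_bigmin; first exact: bigmin_le_id.
by move=> I Ix; apply: bigmin_le_cond; apply: leq_trans Ix (leq_div2r _ xy).
Qed.

Lemma vertex_weight_attained v : (v < n)%N -> vertex_weight v = 1 \/
  exists2 I : 'I_(n %/ m), (I < v %/ m)%N & vertex_weight v = w I.
Proof.
rewrite /vertex_weight => ->.
elim/big_ind: _ => [|x y hx hy|I Iv]; first by left.
  by rewrite minEle; case: ifP.
by right; exists I.
Qed.

(** If no vertex of the edge has weight 1, each takes its weight from a strictly lower block. These
    blocks form a type with the edge itself as witness for [edge_above]. *)
Lemma vertex_weight_cover e : is_kgraph 4 G ->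
  (forall t, edge_above m G t -> 1 <= \sum_(i < 4) w (t i)) ->
  e \in G -> 1 <= \sum_(v in e) vertex_weight v.
Proof.
move=> Gk wcov eG; have [a ainj ea] := edge_enum (Gk _ eG).
rewrite ea big_imset /=; last by move=> i j _ _ /ainj.
have [[i ai]|none1] := boolp.EM (exists i, vertex_weight (a i) = 1).
  by rewrite (bigD1 i) //= ai lerDl sumr_ge0 // => j _; apply: vertex_weight_ge0.
have [q aq wq] : exists2 q : 'I_4 -> 'I_(n %/ m),
    forall i, (q i < a i %/ m)%N & forall i, vertex_weight (a i) = w (q i).
  suff /fin_all_exists[q h] : forall i, exists I : 'I_(n %/ m),
      (I < a i %/ m)%N /\ vertex_weight (a i) = w I.
    by exists q => i; case: (h i).
  move=> i; have [h|[I h1 h2]] := vertex_weight_attained (ltn_ord (a i)).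
    by case: none1; exists i.
  by exists I.
under eq_bigr do rewrite wq.
rewrite (eq_bigr (fun i => w ([ffun i => q i] i))); last by move=> i _; rewrite ffunE.
apply: wcov; exists a; split => //; first by rewrite -ea.
move=> i; rewrite ffunE; apply: leq_trans (leq_divM (a i) m).
by rewrite mulnC leq_mul2r aq orbT.
Qed.

Lemma card_block k : (#|[set v : 'I_n | v %/ m == k]| <= m)%N.
Proof.
pose f (v : 'I_n) : 'I_m := Ordinal (ltn_pmod v m0).
rewrite -(card_in_imset (f := f)); first by rewrite -[leqRHS]card_ord max_card.
move=> x y; rewrite !inE => /eqP xk /eqP yk /(congr1 val) /= xy; apply: val_inj.
by rewrite /= (divn_eq x m) (divn_eq y m) xk yk xy.
Qed.

(** Block 0 has no lower block, so its vertices get the default weight 1, at a cost of at most [m];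
    a vertex of block [I.+1] weighs at most [w I]. *)
Lemma vertex_weight_sum :
  \sum_(v < n) vertex_weight v <= m%:R + m%:R * \sum_I w I.
Proof.
have bound (v : 'I_n) : vertex_weight v <=
    ((v %/ m == 0)%N%:R + \sum_(I < n %/ m) (v %/ m == I.+1)%N%:R * w I).
  have rest : 0 <= \sum_(I < n %/ m) (v %/ m == I.+1)%N%:R * w I.
    by apply: sumr_ge0 => I _; rewrite mulr_ge0 ?ler0n.
  case def_k: (v %/ m)%N => [|k].
    by rewrite eqxx (le_trans (vertex_weight_le1 v)) // lerDl -{1}def_k.
  have kL : (k < n %/ m)%N by rewrite -def_k leq_div2r // ltnW.
  rewrite /= add0r (bigD1 (Ordinal kL)) //= eqxx mul1r -[leLHS]addr0.
  apply: lerD.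
    rewrite /vertex_weight ltn_ord def_k; exact: (@bigmin_le_cond _ _ _ _ (Ordinal kL)).
  by apply: sumr_ge0 => I _; rewrite mulr_ge0 ?ler0n.
apply: le_trans (ler_sum _ (fun v _ => bound v)) _.
have count k : \sum_(v < n) ((v %/ m == k)%N%:R : R) <= m%:R.
  rewrite -natr_sum ler_nat; apply: leq_trans (card_block k).
  by rewrite -sum1dep_card [leqRHS]big_mkcond; apply: leq_sum => v _; case: eqP.
rewrite big_split /= lerD // exchange_big /= mulr_sumr; apply: ler_sum => I _.
by rewrite -mulr_suml ler_wpM2r.
Qed.
End VertexWeights.

Lemma approximate_cover (R : realType) (D : nat) : (0 < D)%N ->
  exists n0 : nat, forall (n s : nat) (G : {set {set 'I_n}}),
    (n0 <= n)%N -> (s < n)%N ->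
    is_kgraph 4 G -> is_stable 4 G -> (matching_number G <= s)%N ->
  exists W : nat -> R,
    [/\ forall v, 0 <= W v <= 1, forall x y, (x <= y)%N -> W y <= W x,
        forall v, (n <= v)%N -> W v = 0,
        \sum_(v < n) W v <= (s + n %/ D)%:R &
        forall e, e \in G -> 1 <= \sum_(v in e) W v].
Proof.
move=> D0; have DR : 0 < D%:R :> R by rewrite ltr0n.
(* With [m] about [n / (4D)], the first block costs at most [n / (4D)], and [q ^+ 5 <= 1 + 31 * h]
   costs at most [31 n / (128 D)]. The remaining room below [n / D] absorbs the rounding. The number
   of blocks stays at most [8D] while [m] grows, as [Lsmall] requires. *)
pose h : R := (128 * D%:R)^-1; pose q := 1 + h.
have h0 : 0 < h by rewrite invr_gt0 mulr_gt0.
have hD : 128 * (h * D%:R) = 1 by rewrite mulrCA mulVf // lt0r_neq0 // mulr_gt0.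
have h1 : h <= 1 by rewrite invf_le1 ?mulr_gt0 //; have : 1 <= D%:R :> R; [rewrite ler1n | lra].
pose c := ((q - 1) / q) ^+ 2.
have c0 : 0 < c.
  by rewrite exprn_gt0 // divr_gt0 /q; lra.
pose m1 := Num.bound (8 * D%:R / c).
exists (4 * D * m1.+1)%N => n s G n0n sn Gk Gst nuG.
pose m := (n %/ (4 * D))%N.
have m1m : (m1 < m)%N by rewrite /m leq_divRL; lia.
have m0 : (0 < m)%N by lia.
have Lm : (n %/ m <= 8 * D)%N.
  have : (n < m.+1 * (4 * D))%N by rewrite ltn_ceil; lia.
  by move=> nm; rewrite -ltnS ltn_divLR //; nia.
have Lsmall : (n %/ m)%:R < 1 + m%:R * c.
  have : 8 * D%:R / c < m%:R.
    have x0 : 0 <= 8 * D%:R / c by apply: divr_ge0 (ltW c0); lra.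
    by apply: lt_trans (archi_boundP x0) _; rewrite ltr_nat.
  rewrite ltr_pdivrMr // => mc.
  have : (n %/ m)%:R <= (8 * D)%:R :> R by rewrite ler_nat.
  by rewrite natrM; move: mc; lra.
have q1 : 1 < q by rewrite /q; lra.
have [|w [w0 wS wcov]] := @fractional_cover R n m (n %/ m) G q s m0 _ q1 Lsmall Gk Gst nuG.
  by rewrite mulnC leq_divM.
exists (vertex_weight w); split.
- by move=> v; rewrite vertex_weight_ge0 // vertex_weight_le1.
- by move=> x y; apply: vertex_weight_anti.
- by move=> v nv; rewrite /vertex_weight ltnNge nv.
- apply: le_trans (vertex_weight_sum m0 w0) _.
  have mR : 0 < m%:R :> R by rewrite ltr0n.
  have {}wS : m%:R * \sum_I w I <= s.+1%:R * q ^+ 5.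
    by rewrite -ler_pdivlMl // mulrC.
  have q5 : q ^+ 5 <= 1 + 31 * h.
    have hp k : h ^+ k.+1 <= h.
      by rewrite exprS ler_piMr ?(ltW h0) // exprn_ile1 // ltW.
    have := (hp 1%N, hp 2, hp 3, hp 4); rewrite /q => -[[[a1 a2] a3] a4].
    by lra.
  have snR : s.+1%:R <= n%:R :> R by rewrite ler_nat.
  have floorD : n%:R <= D%:R * ((n %/ D)%:R + 1) :> R.
    by rewrite natr1 -natrM ler_nat mulnC ltnW // ltn_ceil.
  have m4 : 4 * D%:R * m%:R <= n%:R :> R.
    by rewrite -!natrM ler_nat /m mulnC; apply: leq_divM.
  have n4 : 4 * D%:R <= n%:R :> R.
    by rewrite -natrM ler_nat (leq_trans _ n0n) // leq_pmulr.
  rewrite natrD -(ler_pM2l DR).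
  have s5 : s.+1%:R * q ^+ 5 <= s.+1%:R * (1 + 31 * h) by apply: ler_wpM2l.
  have hD' : h * D%:R = 1 / 128 by lra.
  have e1 : D%:R * (s.+1%:R * (1 + 31 * h)) = s.+1%:R * (D%:R + 31 * (h * D%:R)) by ring.
  have := ler_wpM2l (ltW DR) wS; have := ler_wpM2l (ltW DR) s5.
  rewrite e1 hD'; have sR : s.+1%:R = s%:R + 1 :> R by rewrite natr1.
  by move: floorD m4 n4 snR; rewrite sR; lra.
- by move=> e eG; apply: vertex_weight_cover eG.
Qed.

(** * From weights to edges *)

Lemma sum_ffun4 (V : nmodType) (T : finType) (F : T -> T -> T -> T -> V) :
  \sum_a \sum_b \sum_c \sum_d F a b c d =
  \sum_(f : {ffun 'I_4 -> T}) F (f 0) (f 1) (f 2) (f 3).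
Proof.
rewrite !pair_big /=.
pose h (f : {ffun 'I_4 -> T}) := (f 0, f 1, f 2, f 3).
pose h' (x : T * T * T * T) := [ffun i : 'I_4 => tnth [tuple x.1.1.1; x.1.1.2; x.1.2; x.2] i].
have hK : cancel h h'.
  move=> f; apply/ffunP => i; rewrite ffunE /h /=.
  by case: i => [[|[|[|[|//]]]] i4]; rewrite (tnth_nth (f 0)) /=; congr (f _); apply: val_inj.
have h'K : cancel h' h.
  by case=> [[[a b] c] d]; rewrite /h /h' !ffunE !(tnth_nth a).
rewrite (reindex h) //=; exists h' => ? _; [exact: hK | exact: h'K].
Qed.

(** * Changing the ranges of summation *)

Section NatRanges.
Variable R : realFieldType.
Implicit Types (F : nat -> R) (B : R).

Lemma range_le F B a b N : (forall v, F v <= B) -> 0 <= B -> (b - a <= N)%N ->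
  \sum_(a <= v < b) F v <= N%:R * B.
Proof.
move=> FB B0 abN; apply: le_trans (_ : (b - a)%:R * B <= _); last first.
  by rewrite ler_wpM2r // ler_nat.
by rewrite mulr_natl -sumr_const_nat; apply: ler_sum.
Qed.

Lemma range_extend F F' B a b d : (a <= b)%N -> 0 <= B ->
  (forall v, F v <= B) -> (forall v, F v <= F' v) ->
  \sum_(a <= v < b + d) F v <= \sum_(a <= v < b) F' v + d%:R * B.
Proof.
move=> ab B0 FB FF'; rewrite (big_cat_nat _ (n := b)) ?leq_addr //=.
by apply: lerD; [apply: ler_sum | apply: range_le => //; rewrite addKn].
Qed.

Lemma range_shift F F' B a b d d' : (a + d <= b)%N -> 0 <= B ->
  (forall v, F v <= B) -> (forall v, F v <= F' v) -> (forall v, 0 <= F' v) ->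
  \sum_(a <= v < b) F v <= \sum_(a + d <= v < b + d') F' v + d%:R * B.
Proof.
move=> ab B0 FB FF' F'0; rewrite (big_cat_nat _ (n := (a + d)%N)) ?leq_addr //= addrC.
apply: lerD; last by apply: range_le => //; rewrite addKn.
apply: le_trans (_ : \sum_(a + d <= v < b) F' v <= _); first exact: ler_sum.
by rewrite [leRHS](big_cat_nat _ (n := b)) ?leq_addr //= lerDl sumr_ge0.
Qed.

End NatRanges.

Section WeightSequence.
Variables (R : realFieldType) (W : nat -> R).
Hypothesis W01 : forall v, 0 <= W v <= 1.
Hypothesis Wanti : forall x y, (x <= y)%N -> W y <= W x.

Definition heavy a b c d : R := (1 <= W a + W b + W c + W d)%R%:R.
Definition light a b c d : R := (W a + W b + W c + W d < 1)%R%:R.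

Lemma heavy01 a b c d : 0 <= heavy a b c d <= 1.
Proof. by rewrite /heavy; case: (1 <= _ + W d); rewrite ?(mulr1n, mulr0n) ?lexx ?ler01. Qed.

Lemma light01 a b c d : 0 <= light a b c d <= 1.
Proof. by rewrite /light; case: (_ + W d < 1); rewrite ?(mulr1n, mulr0n) ?lexx ?ler01. Qed.

Lemma sum_shift (F : nat -> R) s n :
  \sum_(s <= v < n) F v = \sum_(i < n - s) F (i + s)%N.
Proof. by rewrite -{1}[s]add0n big_addn big_mkord. Qed.

Lemma sequence_compare s n : (5 * s <= n)%N -> \sum_(v < n) W v <= s%:R ->
  401 * (\sum_(s <= a < n) \sum_(s <= b < n) \sum_(s <= c < n)
           \sum_(s <= d < n) heavy a b c d) <=
  1600 * (\sum_(s <= a < n) \sum_(s <= b < n) \sum_(s <= c < n)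
           \sum_(0 <= j < s) light a b c j).
Proof.
move=> sn sumW.
have := @weights_compare R 'I_(n - s) 'I_s (fun i => W (i + s)%N) (fun j => W j) (W s).
rewrite !card_ord => h.
rewrite !sum_shift; under eq_bigr do rewrite sum_shift.
under eq_bigr do under eq_bigr do rewrite sum_shift.
under eq_bigr do under eq_bigr do under eq_bigr do rewrite sum_shift.
under [X in _ <= 1600 * X]eq_bigr do rewrite sum_shift.
under [X in _ <= 1600 * X]eq_bigr do under eq_bigr do rewrite sum_shift.
under [X in _ <= 1600 * X]eq_bigr do under eq_bigr do under eq_bigr do rewrite big_mkord.
apply: h.
- by move=> i; case/andP: (W01 (i + s)).
- by move=> i; apply: Wanti; rewrite leq_addl.
- by move=> j; apply: Wanti; rewrite ltnW.
- by move=> j; case/andP: (W01 j).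
- by lia.
- have e : \sum_(v < n) W v = \sum_(0 <= v < s) W v + \sum_(s <= v < n) W v.
    by rewrite -big_cat_nat ?big_mkord //; lia.
  by rewrite e big_mkord sum_shift addrC in sumW.
Qed.

(** The cover weighs up to [s + k], so the comparison is made with [s + k] tops among [n + 5k]
    vertices, the added ones having weight 0. Trimming three ranges by [5k] and one by [k] costs 16
    times [k N^3]. *)
Lemma light_trim s n k N : (s + k <= n)%N -> (n + 5 * k <= N)%N ->
  \sum_(s + k <= a < n + 5 * k) \sum_(s + k <= b < n + 5 * k)
    \sum_(s + k <= c < n + 5 * k) \sum_(0 <= j < s + k) light a b c j <=
  \sum_(s + k <= a < n) \sum_(s + k <= b < n)
    \sum_(s + k <= c < n) \sum_(0 <= j < s) light a b c j + 16 * k%:R * N%:R ^+ 3.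
Proof.
move=> skn nN.
have N0 : 0 <= N%:R :> R by rewrite ler0n.
have k0 : 0 <= k%:R :> R by rewrite ler0n.
have kN : (5 * k)%:R = 5 * k%:R :> R by rewrite natrM.
pose T0 a b c := \sum_(0 <= j < s + k) light a b c j.
pose U0 a b c := \sum_(0 <= j < s) light a b c j.
have T0N a b c : T0 a b c <= N%:R.
  rewrite -[leRHS]mulr1; apply: range_le => [v||];
    [by case/andP: (light01 a b c v) | by [] | by lia].
have T0U a b c : T0 a b c <= U0 a b c + k%:R.
  rewrite -[k%:R]mulr1; apply: range_extend => // v; by case/andP: (light01 a b c v).
pose T1 a b := \sum_(s + k <= c < n + 5 * k) T0 a b c.
pose U1 a b := \sum_(s + k <= c < n) U0 a b c.
have T1N a b : T1 a b <= N%:R ^+ 2.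
  by rewrite expr2; apply: range_le => //; lia.
have T1U a b : T1 a b <= U1 a b + 6 * k%:R * N%:R.
  apply: le_trans (range_extend (F' := fun c => U0 a b c + k%:R)
    _ _ N0 (T0N a b) (T0U a b)) _ => //.
  rewrite big_split /= -addrA lerD2l kN.
  have := @range_le R (fun=> k%:R) k%:R (s + k) n N
    (fun=> lexx _) k0.
  by move=> /(_ ltac:(lia)); lra.
pose T2 a := \sum_(s + k <= b < n + 5 * k) T1 a b.
pose U2 a := \sum_(s + k <= b < n) U1 a b.
have T2N a : T2 a <= N%:R ^+ 3.
  by rewrite exprS; apply: range_le => //; rewrite ?exprn_ge0 //; lia.
have T2U a : T2 a <= U2 a + 11 * k%:R * N%:R ^+ 2.
  apply: le_trans (range_extend (F' := fun b => U1 a b + 6 * k%:R * N%:R)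
    _ _ (exprn_ge0 2 N0) (T1N a) (T1U a)) _ => //.
  rewrite big_split /= -addrA lerD2l kN.
  have := @range_le R (fun=> 6 * k%:R * N%:R) (6 * k%:R * N%:R) (s + k) n N
    (fun=> lexx _).
  by rewrite !mulr_ge0 // => /(_ isT ltac:(lia)); lra.
apply: le_trans (range_extend (F' := fun a => U2 a + 11 * k%:R * N%:R ^+ 2)
  _ _ (exprn_ge0 3 N0) T2N T2U) _ => //.
rewrite big_split /= -addrA lerD2l kN.
have := @range_le R (fun=> 11 * k%:R * N%:R ^+ 2) (11 * k%:R * N%:R ^+ 2) (s + k) n N
    (fun=> lexx _).
by rewrite !mulr_ge0 ?exprn_ge0 // => /(_ isT ltac:(lia)); lra.
Qed.

Lemma heavy_trim s n k N : (s + k <= n)%N -> (n + 5 * k <= N)%N ->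
  \sum_(s <= a < n) \sum_(s <= b < n) \sum_(s <= c < n) \sum_(s <= d < n) heavy a b c d <=
  \sum_(s + k <= a < n + 5 * k) \sum_(s + k <= b < n + 5 * k)
    \sum_(s + k <= c < n + 5 * k) \sum_(s + k <= d < n + 5 * k) heavy a b c d
    + 4 * k%:R * N%:R ^+ 3.
Proof.
move=> skn nN.
have N0 : 0 <= N%:R :> R by rewrite ler0n.
have k0 : 0 <= k%:R :> R by rewrite ler0n.
pose T0 a b c := \sum_(s <= d < n) heavy a b c d.
pose U0 a b c := \sum_(s + k <= d < n + 5 * k) heavy a b c d.
have h0 a b c d : 0 <= heavy a b c d by case/andP: (heavy01 a b c d).
have h1 a b c d : heavy a b c d <= 1 by case/andP: (heavy01 a b c d).
have U00 a b c : 0 <= U0 a b c by apply: sumr_ge0.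
have T0N a b c : T0 a b c <= N%:R.
  by rewrite -[leRHS]mulr1; apply: range_le => //; lia.
have T0U a b c : T0 a b c <= U0 a b c + k%:R.
  by rewrite -[k%:R]mulr1; apply: range_shift.
pose T1 a b := \sum_(s <= c < n) T0 a b c.
pose U1 a b := \sum_(s + k <= c < n + 5 * k) U0 a b c.
have U10 a b : 0 <= U1 a b by apply: sumr_ge0.
have T1N a b : T1 a b <= N%:R ^+ 2.
  by rewrite expr2; apply: range_le => //; lia.
have T1U a b : T1 a b <= U1 a b + 2 * k%:R * N%:R.
  apply: le_trans (range_shift (F' := fun c => U0 a b c + k%:R)
    (5 * k) skn N0 (T0N a b) (T0U a b) _) _.
    by move=> v; rewrite addr_ge0.
  rewrite big_split /= -addrA lerD2l.
  have := @range_le R (fun=> k%:R) k%:R (s + k) (n + 5 * k) N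
    (fun=> lexx _) k0.
  by move=> /(_ ltac:(lia)); lra.
pose T2 a := \sum_(s <= b < n) T1 a b.
pose U2 a := \sum_(s + k <= b < n + 5 * k) U1 a b.
have U20 a : 0 <= U2 a by apply: sumr_ge0.
have T2N a : T2 a <= N%:R ^+ 3.
  by rewrite exprS; apply: range_le => //; rewrite ?exprn_ge0 //; lia.
have c1 : 0 <= 2 * k%:R * N%:R :> R by rewrite !mulr_ge0.
have T2U a : T2 a <= U2 a + 3 * k%:R * N%:R ^+ 2.
  apply: le_trans (range_shift (F' := fun b => U1 a b + 2 * k%:R * N%:R)
    (5 * k) skn (exprn_ge0 2 N0) (T1N a) (T1U a) _) _.
    by move=> v; rewrite addr_ge0.
  rewrite big_split /= -addrA lerD2l.
  have := @range_le R (fun=> 2 * k%:R * N%:R) (2 * k%:R * N%:R) (s + k) (n + 5 * k) N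
    (fun=> lexx _) c1.
  by move=> /(_ ltac:(lia)); lra.
have c2 : 0 <= 3 * k%:R * N%:R ^+ 2 :> R by rewrite !mulr_ge0 ?exprn_ge0.
apply: le_trans (range_shift (F' := fun a => U2 a + 3 * k%:R * N%:R ^+ 2)
  (5 * k) skn (exprn_ge0 3 N0) T2N T2U _) _.
  by move=> v; rewrite addr_ge0.
rewrite big_split /= -addrA lerD2l.
have := @range_le R (fun=> 3 * k%:R * N%:R ^+ 2) (3 * k%:R * N%:R ^+ 2) (s + k) (n + 5 * k) N
    (fun=> lexx _) c2.
by move=> /(_ ltac:(lia)); lra.
Qed.
End WeightSequence.

Lemma sum_ffun4_cond (V : nmodType) (T : finType) (P Q : pred T) (F : T -> T -> T -> T -> V) :
  \sum_(a | P a) \sum_(b | P b) \sum_(c | P c) \sum_(d | Q d) F a b c d =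
  \sum_(f : {ffun 'I_4 -> T} | [&& P (f 0), P (f 1), P (f 2) & Q (f 3)])
     (F (f 0) (f 1) (f 2) (f 3)).
Proof.
pose F' a b c d := if [&& P a, P b, P c & Q d] then F a b c d else 0.
rewrite [RHS]big_mkcond -[RHS](sum_ffun4 F') /F'.
rewrite big_mkcond; apply: eq_bigr => a _; case: (P a) => /=; last by rewrite !big1_eq.
rewrite big_mkcond; apply: eq_bigr => b _; case: (P b) => /=; last by rewrite !big1_eq.
rewrite big_mkcond; apply: eq_bigr => c _; case: (P c) => /=; last by rewrite big1_eq.
by rewrite big_mkcond.
Qed.

Lemma sum_diagonal (R : pzSemiRingType) (n : nat) (a : 'I_n) :
  \sum_(b < n) (a == b)%:R = 1 :> R.
Proof.
rewrite (bigD1 a) //= eqxx big1 ?addr0 // => b ba.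
by rewrite eq_sym (negbTE ba).
Qed.

Section Counting.
Variables (R : realFieldType) (n s : nat) (W : nat -> R).

Lemma card_sum_mem (T : finType) (A : {set T}) : #|A|%:R = \sum_x (x \in A)%:R :> R.
Proof. by rewrite -sum1_card natr_sum big_mkcond; apply: eq_bigr => x _; case: (x \in A). Qed.

Lemma sum_labelling (f : {ffun 'I_4 -> 'I_n}) : injective f ->
  \sum_(v in [set f i | i : 'I_4]) W v = W (f 0) + W (f 1) + W (f 2) + W (f 3).
Proof.
move=> finj; rewrite big_imset /=; last by move=> i j _ _ /finj.
rewrite !big_ord_recl big_ord0 addr0 !addrA.
by congr (W (f _) + W (f _) + W (f _) + W (f _)); apply: val_inj.
Qed.

Lemma heavy_labellings (S : {set {set 'I_n}}) : is_kgraph 4 S ->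
  (forall e v, e \in S -> v \in e -> (s <= v)%N) ->
  (forall e, e \in S -> 1 <= \sum_(v in e) W v) ->
  24 * #|S|%:R <= \sum_(s <= a < n) \sum_(s <= b < n) \sum_(s <= c < n)
                    \sum_(s <= d < n) heavy W a b c d.
Proof.
move=> S4 Ss SW; rewrite -[24]/(4`!%:R) -natrM -card_labellings //.
rewrite big_geq_mkord; under eq_bigr do rewrite big_geq_mkord.
under eq_bigr do under eq_bigr do rewrite big_geq_mkord.
under eq_bigr do under eq_bigr do under eq_bigr do rewrite big_geq_mkord.
rewrite /= (sum_ffun4_cond _ _ (fun a b c d : 'I_n => heavy W a b c d)).
rewrite card_sum_mem [leRHS]big_mkcond; apply: ler_sum => f _; rewrite inE.
case: andP => [[/injectiveP finj fS]|_]; last first.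
  by case: ifP => // _; case/andP: (heavy01 W (f 0) (f 1) (f 2) (f 3)).
rewrite !(Ss _ _ fS) ?imset_f //=.
by rewrite /heavy -sum_labelling // SW.
Qed.

(** A light quadruple with distinct bottoms labels an element of [S] with its only top last, and
    [one_top_labellings] counts these. At most [3 n^3] quadruples repeat a bottom, whence
    [12 n^3]. *)
Lemma light_labellings t (S : {set {set 'I_n}}) : is_kgraph 4 S -> (s <= t)%N -> (t <= n)%N ->
  (forall e : {set 'I_n}, #|e| = 4%N -> (exists2 v : 'I_n, v \in e & (v < s)%N) ->
     \sum_(v in e) W v < 1 -> e \in S) ->
  4 * (\sum_(t <= a < n) \sum_(t <= b < n) \sum_(t <= c < n)
        \sum_(0 <= d < s) light W a b c d) <= 24 * #|S|%:R + 12 * n%:R ^+ 3.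
Proof.
move=> S4 st tn lightS.
pose A := [set v : 'I_n | (v < s)%N].
have := one_top_labellings A S; rewrite card_labellings //.
set Q := (X in (4 * #|pred_of_set X|)%N) => QS.
suff h : \sum_(t <= a < n) \sum_(t <= b < n) \sum_(t <= c < n)
        \sum_(0 <= d < s) light W a b c d <= #|Q|%:R + 3 * n%:R ^+ 3.
  have : (4 * #|Q|)%:R <= (24 * #|S|)%:R :> R by rewrite ler_nat.
  by rewrite !natrM; move: h; lra.
rewrite big_geq_mkord; under eq_bigr do rewrite big_geq_mkord.
under eq_bigr do under eq_bigr do rewrite big_geq_mkord.
under eq_bigr do under eq_bigr do under eq_bigr do
  rewrite big_mkord (big_ord_widen n) ?(leq_trans st) //.
rewrite /= (sum_ffun4_cond _ _ (fun a b c d : 'I_n => light W a b c d)).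
have cst (x : R) : \sum_(i < n) x = n%:R * x by rewrite sumr_const card_ord mulr_natl.
have d01 : \sum_(f : {ffun 'I_4 -> 'I_n}) (f 0 == f 1)%:R = n%:R ^+ 3 :> R.
  rewrite -(sum_ffun4 (fun a b c d => (a == b)%:R)).
  under eq_bigr do under eq_bigr do rewrite cst cst.
  by under eq_bigr do rewrite -!mulr_sumr sum_diagonal mulr1; rewrite cst; ring.
have d02 : \sum_(f : {ffun 'I_4 -> 'I_n}) (f 0 == f 2)%:R = n%:R ^+ 3 :> R.
  rewrite -(sum_ffun4 (fun a b c d => (a == c)%:R)).
  under eq_bigr do under eq_bigr do under eq_bigr do rewrite cst.
  under eq_bigr do under eq_bigr do rewrite -!mulr_sumr sum_diagonal mulr1.
  by under eq_bigr do rewrite cst; rewrite cst; ring.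
have d12 : \sum_(f : {ffun 'I_4 -> 'I_n}) (f 1 == f 2)%:R = n%:R ^+ 3 :> R.
  rewrite -(sum_ffun4 (fun a b c d => (b == c)%:R)).
  under eq_bigr do under eq_bigr do under eq_bigr do rewrite cst.
  under eq_bigr do under eq_bigr do rewrite -!mulr_sumr sum_diagonal mulr1.
  by under eq_bigr do rewrite cst; rewrite cst; ring.
rewrite (_ : 3 * n%:R ^+ 3 = n%:R ^+ 3 + n%:R ^+ 3 + n%:R ^+ 3); last by ring.
rewrite -{1}d01 -{1}d02 -{1}d12 card_sum_mem -!big_split /= big_mkcond.
apply: ler_sum => f _.
have [/and4P[f0 f1 f2 f3]|_] := ifP; last by rewrite !addr_ge0 ?ler0n.
have [l1|l0] := boolP (W (f 0) + W (f 1) + W (f 2) + W (f 3) < 1); last first.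
  by rewrite /light (negbTE l0) !addr_ge0 ?ler0n.
rewrite /light l1 mulr1n.
have q0 := ler0n R (f \in Q); have q01 := ler0n R (f 0 == f 1).
have q02 := ler0n R (f 0 == f 2); have q12 := ler0n R (f 1 == f 2).
have [e01|n01] := eqVneq (f 0) (f 1).
  by move: q0 q02 q12; rewrite mulr1n; lra.
have [e02|n02] := eqVneq (f 0) (f 2).
  by move: q0 q12; rewrite mulr1n mulr0n; lra.
have [e12|n12] := eqVneq (f 1) (f 2).
  by move: q0; rewrite mulr1n mulr0n; lra.
rewrite !addr0.
have bigf (i : 'I_4) : (i < 3)%N -> (s <= f i)%N.
  move=> i3; apply: leq_trans st _.
  case: i i3 => [[|[|[|//]]] i4] _.
  - by rewrite (_ : Ordinal i4 = 0) //; apply: val_inj.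
  - by rewrite (_ : Ordinal i4 = 1) //; apply: val_inj.
  - by rewrite (_ : Ordinal i4 = 2) //; apply: val_inj.
have finj : injective f.
  have ne (i : 'I_4) : (i < 3)%N -> f i != f 3.
    by move=> i3; apply: contraTneq f3 => <-; rewrite -leqNgt bigf.
  have E (i : 'I_4) : [\/ i = 0, i = 1, i = 2 | i = 3].
    case: i => [[|[|[|[|//]]]] i4];
      [constructor 1|constructor 2|constructor 3|constructor 4]; exact: val_inj.
  have h0 := ne 0 isT; have h1 := ne 1 isT; have h2 := ne 2 isT.
  move=> i j fij; move: fij n01 n02 n12 h0 h1 h2.
  by case: (E i) => ->; case: (E j) => -> // ->; rewrite ?eqxx.
rewrite ler1n lt0b inE; apply/and3P; split; first exact/injectiveP.
  apply: lightS; rewrite ?card_imset ?card_ord //; last by rewrite sum_labelling.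
  by exists (f 3) => //; apply: imset_f.
apply/forallP => i; rewrite inE; have [i3|] := ltnP i 3.
  rewrite ltnNge bigf //=; apply/eqP/esym/negbTE; apply/eqP => e.
  by move: i3; rewrite e.
move=> i3; have -> : i = 3.
  by apply/val_inj/eqP; rewrite /= eqn_leq i3 andbT -ltnS ltn_ord.
by rewrite f3.
Qed.
End Counting.

(** * Stability and the choice of constants *)

Section Stability.
Variables (R : realFieldType) (n s k : nat) (W : nat -> R) (G : {set {set 'I_n}}).

(** The constant 69 covers [4 * 16] from [light_trim] and [4 * 401 / 400] from [heavy_trim], with
    [N = 2n]. *)
Lemma stability_count :
  (forall v, 0 <= W v <= 1) -> (forall x y, (x <= y)%N -> W y <= W x) ->
  (forall v, (n <= v)%N -> W v = 0) -> \sum_(v < n) W v <= (s + k)%:R ->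
  (forall e, e \in G -> 1 <= \sum_(v in e) W v) ->
  is_kgraph 4 G -> (5 * s <= n)%N -> (5 * k <= n)%N ->
  401 * (24 * #|G :\: H1 n s|%:R) <=
    400 * (24 * #|H1 n s :\: G|%:R + 12 * n%:R ^+ 3 + 69 * k%:R * (2 * n%:R) ^+ 3) :> R.
Proof.
move=> W01 Wanti W0 sumW Wcov Gk sn kn.
have skn : (s + k <= n)%N by lia.
have N2 : (n + 5 * k <= 2 * n)%N by lia.
have sumW' : \sum_(v < n + 5 * k) W v <= (s + k)%:R.
  rewrite -(big_mkord xpredT W) (big_cat_nat _ (n := n)) ?leq_addr //= big_mkord.
  rewrite [X in _ + X]big1_seq ?addr0 // => v.
  by rewrite mem_index_iota => /andP[_ /andP[nv _]]; apply: W0.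
have cmp := sequence_compare W01 Wanti (_ : 5 * (s + k) <= n + 5 * k)%N sumW'.
have {}cmp := cmp ltac:(lia).
have hv := @heavy_labellings R n s W (G :\: H1 n s).
have lt := @light_labellings R n s W (s + k) (H1 n s :\: G).
have ht := @heavy_trim R W s n k (2 * n) skn N2.
have ltr := @light_trim R W s n k (2 * n) skn N2.
rewrite natrM in ht ltr.
have kg1 : is_kgraph 4 (G :\: H1 n s) by move=> e /setDP[/Gk].
have kg2 : is_kgraph 4 (H1 n s :\: G).
  by move=> e /setDP[]; rewrite inE => /andP[/eqP].
have {}hv := hv kg1.
have {}lt := lt kg2 (leq_addr _ _) skn.
have q1 : forall (e : {set 'I_n}) (v : 'I_n), e \in G :\: H1 n s -> v \in e -> (s <= v)%N.
  move=> e v /setDP[eG eH] ve; rewrite leqNgt; apply: contra eH => vs.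
  by apply/H1_edge; [exact: Gk | exists v].
have q2 : forall e : {set 'I_n}, e \in G :\: H1 n s -> 1 <= \sum_(v in e) W v.
  by move=> e /setDP[/Wcov].
have q3 : forall e : {set 'I_n}, #|e| = 4%N -> (exists2 v : 'I_n, v \in e & (v < s)%N) ->
     \sum_(v in e) W v < 1 -> e \in H1 n s :\: G.
  move=> e e4 ev eW; rewrite inE; apply/andP; split; last exact/H1_edge.
  by apply: contraTN eW => /Wcov; rewrite leNgt.
have {}hv := hv q1 q2.
have {}lt := lt q3.
have K0 : 0 <= k%:R * (2 * n%:R) ^+ 3 :> R.
  by rewrite mulr_ge0 ?exprn_ge0 ?mulr_ge0.
move: K0 cmp hv lt ht ltr.
lra.
Qed.
End Stability.

(** The gap between 401 and 400 allows [x] to be eliminated: [y] is at most [401 eps n^4] plus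
    [200 n^3 + 9200 k n^3], and these errors are below [2 eps n^4]. *)
Lemma final_arithmetic (R : realFieldType) (eps n x y k D : R) :
  0 < eps -> 1 <= n -> 0 <= k -> k * D <= n -> 100 * 100 <= eps * D -> 400 <= eps * n ->
  401 * (24 * x) <= 400 * (24 * y + 12 * n ^+ 3 + 69 * k * (2 * n) ^+ 3) ->
  y <= x + eps * n ^+ 4 -> y <= 403 * (eps * n ^+ 4).
Proof.
move=> eps0 n1 k0 kD epsD epsn h1 h2.
have n0 : 0 < n by lra.
have e1 : 400 * n ^+ 3 <= eps * n ^+ 4.
  by rewrite [n ^+ 4]exprS mulrA ler_wpM2r // exprn_ge0 // ltW.
have kn : 100 * 100 * k <= eps * n.
  have := ler_wpM2r k0 epsD; have := ler_wpM2l (ltW eps0) kD; lra.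
have e2 : 100 * 100 * k * n ^+ 3 <= eps * n ^+ 4.
  by rewrite [n ^+ 4]exprS mulrA ler_wpM2r // exprn_ge0 // ltW.
have : 0 <= eps * n ^+ 4 by rewrite mulr_ge0 ?exprn_ge0 ?ltW.
lra.
Qed.

From mathcomp Require Import all_classical all_reals all_analysis.

Theorem theorem1p2 (R : realType) (c : R) (hc0 : 0 < c) (hc1 : c < 1 / 5) :
  exists2 eps0 : R, 0 < eps0 &
  forall eps : R, 0 < eps -> eps < eps0 ->
  exists n0 : nat, forall n s : nat, (n0 <= n)%N ->
    c * n%:R <= s%:R -> s%:R <= n%:R / 5 :> R ->
  forall G : {set {set 'I_n}},
    is_kgraph 4 G -> is_stable 4 G -> (matching_number G <= s)%N ->
    'C(n, 4)%:R - 'C(n - s, 4)%:R - eps * n%:R ^+ 4 <= #|G|%:R ->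
    eps_close 4 (400 * eps `^ (1 / 4)) G (H1 n s).
Proof.
(* For [eps < 1/16] the fourth root [y] is below 1/2, so [403 * y ^+ 4 <= 403 / 8 * y < 400 * y]. *)
exists (1 / 16) => [|eps eps0 eps16]; first lra.
(* The five successors give [D >= 5], so that five times [n %/ D] is at most [n]. *)
pose D := (Num.bound (100 * 100 / eps)).+4.+1.
have [n0 cover] := @approximate_cover R D isT.
exists (maxn n0 (Num.bound (400 / eps)).+1) => n s.
rewrite geq_max => /andP[n0n n1n] _ s5 G Gk Gst nuG eG.
have n_gt0 : (0 < n)%N by apply: leq_trans n1n.
have sn : (5 * s <= n)%N.
  by rewrite -(ler_nat R) natrM; move: s5; rewrite ler_pdivlMr // mulrC.
have [|W [W01 Wanti W0 sumW Wcov]] := cover n s G n0n _ Gk Gst nuG; first by lia.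
have kD : (n %/ D * D <= n)%N := leq_divM n D.
have k5 : (5 * (n %/ D) <= n)%N.
  by apply: leq_trans kD; rewrite mulnC leq_mul2l; apply/orP; right.
have main := stability_count W01 Wanti W0 sumW Wcov Gk sn k5.
have cardH := card_H1 (leq_trans (leq_pmull s (isT : 0 < 5)%N) sn).
have y_le : #|H1 n s :\: G|%:R <= #|G :\: H1 n s|%:R + eps * n%:R ^+ 4 :> R.
  have hG := cardsID (H1 n s) G; have hH := cardsID G (H1 n s).
  rewrite finset.setIC in hH.
  move/(congr1 (fun m => m%:R : R)) : cardH; rewrite natrD => cardH.
  move/(congr1 (fun m => m%:R : R)) : hG; rewrite natrD => hG.
  move/(congr1 (fun m => m%:R : R)) : hH; rewrite natrD => hH.
  by move: eG; lra.
have bounded (x : R) (m : nat) : 0 < x -> (Num.bound (x / eps) <= m)%N -> x <= eps * m%:R.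
  move=> x0 bm; rewrite mulrC -ler_pdivrMr //.
  have x0' : 0 <= x / eps by rewrite divr_ge0 ?ltW.
  by apply: ltW; apply: lt_le_trans (archi_boundP x0') _; rewrite ler_nat.
have fin : #|H1 n s :\: G|%:R <= 403 * (eps * n%:R ^+ 4) :> R.
  apply: (@final_arithmetic R eps n%:R _ _ (n %/ D)%:R D%:R) main y_le => //.
  - by rewrite ler1n.
  - by rewrite -natrM ler_nat.
  - by apply: bounded; [lra | rewrite /D; do 5! apply: leqW].
  - by apply: bounded; [lra | exact: ltnW].
rewrite /eps_close; apply: le_lt_trans fin _.
pose y : R := eps `^ (1 / 4).
have y0 : 0 < y by rewrite powR_gt0.
have y4 : y ^+ 4 = eps.
  by rewrite -powR_mulrn ?powR_ge0 // -powRrM mul1r mulVf // powRr1 // ltW.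
have y12 : y < 1 / 2.
  rewrite -(ltr_pXn2r (n := 4)) ?nnegrE ?ltW // y4; lra.
rewrite mulrA ltr_pM2r ?exprn_gt0 ?ltr0n //.
rewrite -/y -y4.
have : y ^+ 3 <= 1 / 8.
  have -> : 1 / 8 = (1 / 2) ^+ 3 :> R by field.
  by rewrite lerXn2r ?nnegrE ?ltW //; lra.
rewrite exprS => y3; have := ler_wpM2l (ltW y0) y3.
lra.
Qed.
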